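(* Let $f:\subseteq\mathbf R^m\to\mathbf R^n$, $g:\subseteq\mathbf R^{m+1+n}\to\mathbf R^n$, and for $\vec v\in\mathbf R^m$ let $H_{\vec v}$ and $h_{\vec v}$ be as in the definition of $\mathrm{PR}$ (see context). (i) If $g$ is analytic with open domain, then for every $\vec v$, $H_{\vec v}$ is exactly the set of restrictions of $h_{\vec v}$ to sets that are empty or intervals containing $0$. (ii) If $f$ and $g$ are analytic with open domains, then $\mathrm{PR}(f,g)$ is analytic with open domain.
   Context: Functions may be partial, with domain $\operatorname{dom}$. The restriction of $h$ to a set $J$ is the function with domain $J\cap\operatorname{dom} h$ agreeing with $h$ there. Differential recursion: for $f:\subseteq\mathbf R^m\to\mathbf R^n$, $g:\subseteq\mathbf R^{m+1+n}\to\mathbf R^n$ and $\vec v\in\mathbf R^m$, let $H_{\vec v}$ be the set of all $h:\subseteq\mathbf R\to\mathbf R^n$ such that (1) $\operatorname{dom} h$ is empty or a (possibly unbounded) interval containing $0$; (2) $\vec v\in\operatorname{dom} f$ if $\operatorname{dom} h\ne\emptyset$; (3) $(\vec v,\tau,h\tau)\in\operatorname{dom} g$ for every $\tau\in\operatorname{dom} h$; (4) $h t=f\vec v+\int_0^t g(\vec v,\tau,h\tau)\,d\tau$ for every $t\in\operatorname{dom} h$. A function $h\in H$ is unique in a set $H$ if for every $h'\in H$, $h'$ and $h$ agree on $\operatorname{dom} h\cap\operatorname{dom} h'$. Let $K_{\vec v}$ be the set of functions unique in $H_{\vec v}$ (these agree on common domains) and let $h_{\vec v}$ be their union. Define $\mathrm{PR}(f,g):\subseteq\mathbf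 R^{m+1}\to\mathbf R^n$ by $\operatorname{dom}\mathrm{PR}(f,g)=\{(\vec v,t)\mid t\in\operatorname{dom} h_{\vec v}\}$ and $\mathrm{PR}(f,g)(\vec v,t)=h_{\vec v}t$. *)

(* Defs.v *)
From Stdlib Require Import Reals List.
Open Scope R_scope.

(* A partial function: a domain predicate and a (total) value function,
   only meaningful on the domain.  Points of R^k are lists of length k. *)
Record pfun (A B : Type) := PFun { pdom : A -> Prop; pval : A -> B }.
Arguments PFun {A B}.
Arguments pdom {A B}.
Arguments pval {A B}.

Definition vecfun_wf (k n : nat) (f : pfun (list R) (list R)) : Prop :=
  forall x, pdom f x -> length x = k /\ length (pval f x) = n.

Definition graph_of {A B : Type} (f : pfun A B) : A -> B -> Prop :=
  fun x y => pdom f x /\ pval f x = y.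

Fixpoint box_sum (k N : nat) (F : list nat -> R) : R :=
  match k with
  | O => F nil
  | S k' => sum_f_R0 (fun a => box_sum k' N (fun l => F (a :: l))) N
  end.

Fixpoint monom (a : list nat) (d : list R) : R :=
  match a, d with
  | a0 :: a', d0 :: d' => d0 ^ a0 * monom a' d'
  | _, _ => 1
  end.

Fixpoint vsub (x y : list R) : list R :=
  match x, y with
  | x0 :: x', y0 :: y' => (x0 - y0) :: vsub x' y'
  | _, _ => nil
  end.

Definition in_ball (k : nat) (x : list R) (r : R) (y : list R) : Prop :=
  length y = k /\ forall i, (i < k)%nat -> Rabs (nth i y 0 - nth i x 0) < r.

Definition open_dom (k : nat) (G : list R -> list R -> Prop) : Prop :=
  forall x z, G x z -> exists eps, 0 < eps /\
    forall y, in_ball k x eps y -> exists w, G y w.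

Definition analytic (k n : nat) (G : list R -> list R -> Prop) : Prop :=
  forall x z, G x z -> exists r, 0 < r /\
    exists c : list nat -> nat -> R,
      (exists B, forall N j, (j < n)%nat ->
          box_sum k N (fun a => Rabs (c a j) * monom a (repeat r k)) <= B) /\
      (forall y w, in_ball k x r y -> G y w -> forall j, (j < n)%nat ->
          Un_cv (fun N => box_sum k N (fun a => c a j * monom a (vsub y x)))
                (nth j w 0)).

Definition dom_ok (D : R -> Prop) : Prop :=
  (forall t, ~ D t) \/
  (D 0 /\ forall a b c, D a -> D b -> a <= c <= b -> D c).

Definition Hset (n : nat) (f g : pfun (list R) (list R)) (v : list R)
    (h : pfun R (list R)) : Prop :=
  dom_ok (pdom h) /\
  (forall t, pdom h t -> pdom f v) /\
  (forall t, pdom h t -> pdom g (v ++ t :: pval h t)) /\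
  (forall t, pdom h t -> length (pval h t) = n /\
     forall j, (j < n)%nat ->
       exists pr : Riemann_integrable
                     (fun tau => nth j (pval g (v ++ tau :: pval h tau)) 0) 0 t,
         nth j (pval h t) 0 = nth j (pval f v) 0 + RiemannInt pr).

Definition unique_in (H : pfun R (list R) -> Prop) (h : pfun R (list R)) : Prop :=
  H h /\ forall h', H h' -> forall t, pdom h t -> pdom h' t -> pval h t = pval h' t.

Definition hv_graph (n : nat) (f g : pfun (list R) (list R)) (v : list R)
    (t : R) (y : list R) : Prop :=
  exists h, unique_in (Hset n f g v) h /\ pdom h t /\ pval h t = y.

Definition PR_graph (m n : nat) (f g : pfun (list R) (list R))
    (x y : list R) : Prop :=
  exists v t, length v = m /\ x = v ++ t :: nil /\ hv_graph n f g v t y.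

(* Main.v *)
(* Let an analytic function near x be one given on a polydisc by a power series
   whose absolute sum is at most B.  These pairs (function, B) contain the
   monomials and are closed under countable sums with summable bounds; expanding
   one factor into monomials then gives products, compositions and integrals,
   together with their bounds.  With respect to the bounds, Picard iteration for
   u' = g(v, t, u) with initial value y is a contraction on a small polydisc,
   so its limit is analytic in (v, t, y) jointly.  Continuity along a given
   solution carries analyticity of v |-> h_v(s) from s = 0 to every time of the
   domain, each step being a composition with such a local flow.  Uniqueness
   comes from the same Lipschitz estimate, so every member of H_v is unique in
   H_v, and part (i) follows. *)

Require Import Defs.
From Coquelicot Require Import Coquelicot.
From Stdlib Require Import Reals List Lra Lia IndefiniteDescription Classical.
Open Scope R_scope.

(** A uniform limit of real analytic functions need not be analytic, and a sup bound over the reals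
    does not control coefficients. So the bound [B] is on the weighted l1 norm, the sum of |c_a|
    r^|a|, which is submultiplicative and compatible with countable sums. The coefficients of
    products, compositions and flows are never written down: they come out of such sums. Three
    points shape the flow. It is centred at a point (s, v0, h(s)) of the given solution, but may
    start at any time [sg] near s, with a radius fixed before [sg]; this uniformity keeps the steps
    along the time axis from shrinking. It must be analytic in the initial value, because at the
    starting time this value is itself a function of v. Finally, the domain of the given solution
    may end at the time under study, while an open domain needs later times: a flow started earlier
    supplies them for all nearby parameters. *)

(** * Sums over boxes of multi-indices *)

Lemma box_sum_ext k N F G :
  (forall a, length a = k -> F a = G a) -> box_sum k N F = box_sum k N G.
Proof.
  revert F G; induction k as [|k IH]; intros F G E; simpl.
  - now apply E.
  - apply sum_eq; intros i _. apply IH. intros a Ha. apply E. simpl; lia.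
Qed.

Lemma box_sum_le k N F G :
  (forall a, length a = k -> F a <= G a) -> box_sum k N F <= box_sum k N G.
Proof.
  revert F G; induction k as [|k IH]; intros F G E; simpl.
  - now apply E.
  - apply sum_Rle; intros i _. apply IH. intros a Ha. apply E. simpl; lia.
Qed.

Lemma box_sum_plus k N F G :
  box_sum k N (fun a => F a + G a) = box_sum k N F + box_sum k N G.
Proof.
  revert F G; induction k as [|k IH]; intros F G; simpl; [reflexivity|].
  rewrite <- sum_plus. apply sum_eq; intros i _. apply IH.
Qed.

Lemma box_sum_scal k N s F :
  box_sum k N (fun a => s * F a) = s * box_sum k N F.
Proof.
  revert F; induction k as [|k IH]; intros F; simpl; [reflexivity|].
  rewrite scal_sum. apply sum_eq; intros i _. rewrite IH. ring.
Qed.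

Lemma box_sum_0 k N : box_sum k N (fun _ => 0) = 0.
Proof.
  rewrite (box_sum_ext k N _ (fun a => 0 * 0)) by (intros; ring).
  rewrite box_sum_scal. ring.
Qed.

Lemma box_sum_pos k N F :
  (forall a, length a = k -> 0 <= F a) -> 0 <= box_sum k N F.
Proof. intros H. rewrite <- (box_sum_0 k N). now apply box_sum_le. Qed.

Lemma box_sum_abs k N F : Rabs (box_sum k N F) <= box_sum k N (fun a => Rabs (F a)).
Proof.
  revert F; induction k as [|k IH]; intros F; simpl; [apply Rle_refl|].
  eapply Rle_trans; [apply Rsum_abs|]. apply sum_Rle; intros i _. apply IH.
Qed.

Lemma sum_f_R0_pos u N : (forall i, (i <= N)%nat -> 0 <= u i) -> 0 <= sum_f_R0 u N.
Proof.
  intros H. replace 0 with (sum_f_R0 (fun _ => 0) N).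
  - now apply sum_Rle.
  - rewrite sum_cte. ring.
Qed.

Lemma sum_f_R0_term u N i :
  (forall i, 0 <= u i) -> (i <= N)%nat -> u i <= sum_f_R0 u N.
Proof.
  intros H Hi; induction N as [|N IH].
  - replace i with 0%nat by lia. apply Rle_refl.
  - simpl. destruct (Nat.eq_dec i (S N)) as [->|].
    + assert (0 <= sum_f_R0 u N) by (apply sum_f_R0_pos; auto). lra.
    + specialize (H (S N)). assert (u i <= sum_f_R0 u N) by (apply IH; lia). lra.
Qed.

Lemma box_sum_mono k N F :
  (forall a, length a = k -> 0 <= F a) -> box_sum k N F <= box_sum k (S N) F.
Proof.
  revert F; induction k as [|k IH]; intros F H; simpl; [apply Rle_refl|].
  apply Rle_trans with (sum_f_R0 (fun a => box_sum k (S N) (fun l => F (a :: l))) N).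
  - apply sum_Rle; intros i _. apply IH. intros a Ha; apply H; simpl; lia.
  - assert (0 <= box_sum k (S N) (fun l => F (S N :: l))); [|lra].
    apply box_sum_pos. intros a Ha; apply H; simpl; lia.
Qed.

Lemma box_sum_mono_le k N M F :
  (forall a, length a = k -> 0 <= F a) -> (N <= M)%nat ->
  box_sum k N F <= box_sum k M F.
Proof.
  intros H; induction 1 as [|M _ IH]; [apply Rle_refl|].
  eapply Rle_trans; [exact IH|]. now apply box_sum_mono.
Qed.

(** Every multi-index lies in some box. This turns a bound on all box sums into a bound on each
    coefficient, so that coefficients can be summed one multi-index at a time. *)
Lemma box_sum_term k a F :
  length a = k -> (forall a, length a = k -> 0 <= F a) ->
  exists N, F a <= box_sum k N F.
Proof.
  revert k F; induction a as [|i a IH]; intros k F Hk H; destruct k as [|k];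
    try discriminate Hk.
  - exists 0%nat. apply Rle_refl.
  - injection Hk as Hk.
    destruct (IH k (fun l => F (i :: l)) Hk) as [N HN].
    { intros b Hb; apply H; simpl; lia. }
    exists (Nat.max i N). simpl. eapply Rle_trans; [exact HN|].
    eapply Rle_trans; [apply (box_sum_mono_le k N (Nat.max i N)); [|lia]|].
    { intros b Hb; apply H; simpl; lia. }
    apply (sum_f_R0_term (fun j => box_sum k (Nat.max i N) (fun l => F (j :: l)))); [|lia].
    intros j; apply box_sum_pos. intros b Hb; apply H; simpl; lia.
Qed.

Lemma box_sum_exchange k N M (F : nat -> list nat -> R) :
  box_sum k N (fun a => sum_f_R0 (fun i => F i a) M) =
  sum_f_R0 (fun i => box_sum k N (F i)) M.
Proof.
  induction M as [|M IH]; simpl; [reflexivity|].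
  rewrite box_sum_plus, IH. reflexivity.
Qed.

(** * Limits of sequences and series, dominated convergence *)

Lemma Un_cv_const c : Un_cv (fun _ => c) c.
Proof. intros e He. exists 0%nat. intros. rewrite R_dist_eq. lra. Qed.

Lemma Un_cv_ext u v l : (forall n, u n = v n) -> Un_cv u l -> Un_cv v l.
Proof.
  intros E H e He. destruct (H e He) as [N HN]. exists N. intros n Hn.
  rewrite <- E. now apply HN.
Qed.

Lemma Un_cv_le u l B : (forall n, u n <= B) -> Un_cv u l -> l <= B.
Proof.
  intros H Hl. apply (Rle_cv_lim (Un := u) (Vn := fun _ => B)); auto using Un_cv_const.
Qed.

Lemma Un_cv_abs_le u l B : (forall n, Rabs (u n) <= B) -> Un_cv u l -> Rabs l <= B.
Proof.
  intros H Hl. apply (Un_cv_le (fun n => Rabs (u n))); [exact H|].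
  now apply cv_cvabs.
Qed.

Lemma Un_cv_scal s u l : Un_cv u l -> Un_cv (fun n => s * u n) (s * l).
Proof. intros H. apply CV_mult; [apply Un_cv_const|exact H]. Qed.

Lemma sum_f_R0_cv N (F : nat -> nat -> R) G :
  (forall i, (i <= N)%nat -> Un_cv (fun L => F L i) (G i)) ->
  Un_cv (fun L => sum_f_R0 (F L) N) (sum_f_R0 G N).
Proof.
  induction N as [|N IH]; intros H; simpl.
  - now apply H.
  - apply (CV_plus (fun L => sum_f_R0 (F L) N) (fun L => F L (S N))).
    + apply IH. intros; apply H; lia.
    + apply H; lia.
Qed.

Lemma box_sum_cv k N (F : nat -> list nat -> R) G :
  (forall a, length a = k -> Un_cv (fun L => F L a) (G a)) ->
  Un_cv (fun L => box_sum k N (F L)) (box_sum k N G).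
Proof.
  revert F G; induction k as [|k IH]; intros F G H; simpl.
  - now apply H.
  - apply (sum_f_R0_cv N (fun L a => box_sum k N (fun l => F L (a :: l)))).
    intros i _. apply (IH (fun L l => F L (i :: l))).
    intros a Ha. apply H. simpl; lia.
Qed.

Lemma Series_abs_bounded u K :
  (forall N, sum_f_R0 (fun i => Rabs (u i)) N <= K) ->
  Un_cv (sum_f_R0 u) (Series u).
Proof.
  intros H.
  assert (E : ex_series (fun i => Rabs (u i))).
  { destruct (ex_finite_lim_seq_incr (sum_n (fun i => Rabs (u i))) K) as [l Hl].
    - intros n. rewrite sum_Sn. unfold plus; simpl.
      assert (0 <= Rabs (u (S n))) by apply Rabs_pos. lra.
    - intros n. rewrite sum_n_Reals. apply H.
    - exists l. exact Hl. }
  apply ex_series_Rabs in E. apply Series_correct in E.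
  apply is_lim_seq_Reals. apply is_lim_seq_ext with (2 := E).
  intros n. apply sum_n_Reals.
Qed.

Lemma sum_f_R0_split u L p :
  sum_f_R0 u (L + S p) = sum_f_R0 u L + sum_f_R0 (fun i => u (S L + i)%nat) p.
Proof.
  induction p as [|p IH].
  - replace (L + 1)%nat with (S L) by lia. simpl. now rewrite Nat.add_0_r.
  - replace (L + S (S p))%nat with (S (L + S p)) by lia. simpl.
    rewrite IH. replace (S (L + S p))%nat with (S (L + S p)) by lia.
    simpl. rewrite Rplus_assoc. do 3 f_equal.
Qed.

(** The remainder is the limit of the finite blocks starting at [S L], and each block is dominated
    by the same block of [B]. *)
Lemma cv_tail_le f F B Binf L :
  (forall i, Rabs (f i) <= B i) -> Un_cv (sum_f_R0 f) F ->
  (forall N, sum_f_R0 B N <= Binf) ->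
  Rabs (F - sum_f_R0 f L) <= Binf - sum_f_R0 B L.
Proof.
  intros Hf HF HB.
  apply (Un_cv_abs_le (fun p => sum_f_R0 (fun i => f (S L + i)%nat) p)).
  - intros p. eapply Rle_trans; [apply Rsum_abs|].
    eapply Rle_trans; [apply sum_Rle; intros i _; apply Hf|].
    specialize (HB (L + S p)%nat). rewrite sum_f_R0_split in HB. lra.
  - intros e He. destruct (HF e He) as [N HN]. exists N. intros p Hp.
    specialize (HN (L + S p)%nat ltac:(lia)). rewrite sum_f_R0_split in HN.
    unfold Rdist in *. replace (_ - (F - _)) with
      (sum_f_R0 f L + sum_f_R0 (fun i => f (S L + i)%nat) p - F) by ring.
    exact HN.
Qed.

(** Dominated convergence for series: the limit in [M] passes through the sum over [i], because the
    terms have a summable bound independent of [M]. *)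
Lemma tannery (s : nat -> nat -> R) B K f F S :
  (forall M i, Rabs (s M i) <= B i) ->
  (forall N, sum_f_R0 B N <= K) ->
  (forall i, Un_cv (fun M => s M i) (f i)) ->
  (forall M, Un_cv (sum_f_R0 (s M)) (S M)) ->
  Un_cv (sum_f_R0 f) F ->
  Un_cv S F.
Proof.
  intros Hs HK Hsf HS HF.
  assert (HB0 : forall i, 0 <= B i).
  { intros i. eapply Rle_trans; [apply Rabs_pos|apply (Hs 0%nat i)]. }
  assert (Hf : forall i, Rabs (f i) <= B i).
  { intros i. apply (Un_cv_abs_le (fun M => s M i)); auto. }
  assert (HBs : Un_cv (sum_f_R0 B) (Series B)).
  { apply (Series_abs_bounded B K). intros N.
    rewrite (sum_eq _ B); [apply HK|]. intros i _. apply Rabs_pos_eq, HB0. }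
  assert (HBle : forall N, sum_f_R0 B N <= Series B).
  { intros N. apply growing_ineq; [|exact HBs].
    intros n. simpl. specialize (HB0 (Datatypes.S n)). lra. }
  intros e He.
  (* Beyond [L] both series have tails below e/3, uniformly in [M]; the finitely many terms up to
     [L] account for the last third. *)
  destruct (HBs (e/3) ltac:(lra)) as [L HL]. specialize (HL L (Nat.le_refl L)).
  unfold Rdist in HL. rewrite Rabs_minus_sym in HL.
  assert (HL' : Series B - sum_f_R0 B L < e / 3).
  { eapply Rle_lt_trans; [apply Rle_abs|exact HL]. }
  destruct (sum_f_R0_cv L s f (fun i _ => Hsf i) (e/3) ltac:(lra)) as [M0 HM].
  exists M0. intros M HMM. specialize (HM M HMM). unfold Rdist in *.
  assert (T1 := cv_tail_le (s M) (S M) B (Series B) L (Hs M) (HS M) HBle).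
  assert (T2 := cv_tail_le f F B (Series B) L Hf HF HBle).
  apply Rabs_def2 in HM. apply Rabs_le_between in T1. apply Rabs_le_between in T2.
  apply Rabs_def1; lra.
Qed.

(** * Monomials and coordinate differences *)

Lemma monom_abs_le k r a d :
  length d = k -> (forall i, (i < k)%nat -> Rabs (nth i d 0) <= r) ->
  Rabs (monom a d) <= monom a (repeat r k).
Proof.
  revert k d; induction a as [|i a IH]; intros k d Hk H.
  - simpl. rewrite Rabs_R1. lra.
  - destruct d as [|t d]; destruct k as [|k]; try discriminate Hk; simpl.
    + rewrite Rabs_R1; lra.
    + rewrite Rabs_mult, <- RPow_abs. injection Hk as Hk.
      apply Rmult_le_compat; try apply Rabs_pos.
      * apply pow_le, Rabs_pos.
      * apply pow_incr. split; [apply Rabs_pos|]. apply (H 0%nat). lia.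
      * apply IH; [exact Hk|]. intros j Hj. apply (H (S j)). lia.
Qed.

Lemma monom_repeat_pos a r k : 0 < r -> 0 < monom a (repeat r k).
Proof.
  intros Hr; revert k; induction a as [|i a IH]; intros [|k]; simpl; try lra.
  apply Rmult_lt_0_compat; [now apply pow_lt|apply IH].
Qed.

Lemma monom_repeat_le a r s k :
  0 < r <= s -> monom a (repeat r k) <= monom a (repeat s k).
Proof.
  intros Hr. rewrite <- (Rabs_pos_eq (monom a (repeat r k)))
    by (left; apply monom_repeat_pos; lra).
  apply monom_abs_le; [apply repeat_length|]. intros i Hi.
  rewrite nth_repeat_lt by exact Hi. rewrite Rabs_pos_eq; lra.
Qed.

Lemma vsub_length x y : length x = length y -> length (vsub x y) = length x.
Proof.
  revert y; induction x as [|a x IH]; intros [|b y] H; try discriminate H; simpl; auto.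
Qed.

Lemma vsub_nth i x y :
  length x = length y -> nth i (vsub x y) 0 = nth i x 0 - nth i y 0.
Proof.
  revert i y; induction x as [|a x IH]; intros i [|b y] H; try discriminate H;
    destruct i; simpl; try ring; auto.
Qed.

(** * Functions given by an absolutely convergent power series *)

(** For [a] of length [k], [monom a (repeat r k)] is r^|a|, so [B] bounds the weighted l1 norm of
    the coefficients and not merely the sup norm. [F] is constrained on the open polydisc only,
    which lets total functions with arbitrary values elsewhere stand for partial ones. *)
Definition ana (k : nat) (x : list R) (r : R) (F : list R -> R) (B : R) : Prop :=
  length x = k /\ 0 < r /\
  exists c : list nat -> R,
    (forall N, box_sum k N (fun a => Rabs (c a) * monom a (repeat r k)) <= B) /\
    (forall y, in_ball k x r y ->
       Un_cv (fun N => box_sum k N (fun a => c a * monom a (vsub y x))) (F y)).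

Lemma ana_term_le k x r y a :
  length x = k -> in_ball k x r y ->
  Rabs (monom a (vsub y x)) <= monom a (repeat r k).
Proof.
  intros Hx [Hy H]. apply monom_abs_le; [rewrite vsub_length; lia|].
  intros i Hi. rewrite vsub_nth by lia. left. apply H, Hi.
Qed.

Lemma ana_sum_le k x r c y N :
  length x = k -> in_ball k x r y ->
  Rabs (box_sum k N (fun a => c a * monom a (vsub y x))) <=
  box_sum k N (fun a => Rabs (c a) * monom a (repeat r k)).
Proof.
  intros Hx Hy. eapply Rle_trans; [apply box_sum_abs|].
  apply box_sum_le; intros a _. rewrite Rabs_mult.
  apply Rmult_le_compat_l; [apply Rabs_pos|]. now apply ana_term_le.
Qed.

Lemma ana_bound k x r F B y : ana k x r F B -> in_ball k x r y -> Rabs (F y) <= B.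
Proof.
  intros (Hx & Hr & c & Hc & HF) Hy. specialize (HF y Hy).
  refine (Un_cv_abs_le _ _ _ _ HF). intros N.
  cbv beta. eapply Rle_trans; [apply (ana_sum_le k x r); assumption|apply Hc].
Qed.

Lemma in_ball_center k x r : length x = k -> 0 < r -> in_ball k x r x.
Proof.
  intros Hx Hr. split; [exact Hx|]. intros i _. rewrite Rminus_diag, Rabs_R0. exact Hr.
Qed.

Lemma ana_bound_pos k x r F B : ana k x r F B -> 0 <= B.
Proof.
  intros H. eapply Rle_trans; [apply Rabs_pos|]. apply (ana_bound _ _ _ _ _ x H).
  apply in_ball_center; apply H.
Qed.

Lemma ana_ext k x r F G B :
  (forall y, in_ball k x r y -> F y = G y) -> ana k x r F B -> ana k x r G B.
Proof.
  intros E (Hx & Hr & c & Hc & HF). repeat split; try assumption.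
  exists c; split; [exact Hc|]. intros y Hy. rewrite <- E by exact Hy. now apply HF.
Qed.

Lemma ana_le k x r F B B' : B <= B' -> ana k x r F B -> ana k x r F B'.
Proof.
  intros E (Hx & Hr & c & Hc & HF). repeat split; try assumption.
  exists c; split; [|exact HF]. intros N; eapply Rle_trans; [apply Hc|exact E].
Qed.

Lemma ana_plus k x r F G B C :
  ana k x r F B -> ana k x r G C -> ana k x r (fun y => F y + G y) (B + C).
Proof.
  intros (Hx & Hr & c & Hc & HF) (_ & _ & d & Hd & HG). repeat split; try assumption.
  exists (fun a => c a + d a); split.
  - intros N. eapply Rle_trans; [|apply Rplus_le_compat; [apply Hc|apply Hd]].
    rewrite <- box_sum_plus. apply box_sum_le; intros a _.
    rewrite <- Rmult_plus_distr_r. apply Rmult_le_compat_r; [|apply Rabs_triang].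
    left; now apply monom_repeat_pos.
  - intros y Hy. eapply Un_cv_ext; [|apply CV_plus; [apply HF|apply HG]; exact Hy].
    intros N; simpl. rewrite <- box_sum_plus. apply box_sum_ext; intros; ring.
Qed.

Lemma ana_scal k x r s F B :
  ana k x r F B -> ana k x r (fun y => s * F y) (Rabs s * B).
Proof.
  intros (Hx & Hr & c & Hc & HF). repeat split; try assumption.
  exists (fun a => s * c a); split.
  - intros N. rewrite (box_sum_ext _ _ _
      (fun a => Rabs s * (Rabs (c a) * monom a (repeat r k)))).
    + rewrite box_sum_scal. apply Rmult_le_compat_l; [apply Rabs_pos|apply Hc].
    + intros; rewrite Rabs_mult; ring.
  - intros y Hy. eapply Un_cv_ext; [|apply Un_cv_scal, HF, Hy].
    intros N; simpl. rewrite <- box_sum_scal. apply box_sum_ext; intros; ring.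
Qed.

Lemma ana_minus k x r F G B C :
  ana k x r F B -> ana k x r G C -> ana k x r (fun y => F y - G y) (B + C).
Proof.
  intros HF HG. eapply ana_ext; [|eapply ana_le; [|apply ana_plus;
    [exact HF|apply (ana_scal _ _ _ (-1)); exact HG]]].
  - intros y _; simpl; ring.
  - rewrite Rabs_m1. lra.
Qed.

(** * Single monomials and countable sums *)

Definition delta (b a : list nat) : R := if list_eq_dec Nat.eq_dec a b then 1 else 0.

Lemma sum_f_R0_single u i N :
  (i <= N)%nat -> (forall j, j <> i -> u j = 0) -> sum_f_R0 u N = u i.
Proof.
  intros Hi H; induction N as [|N IH]; simpl.
  - f_equal; lia.
  - destruct (Nat.eq_dec i (S N)) as [->|].
    + rewrite (sum_eq u (fun _ => 0) N); [rewrite sum_cte; ring|].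
      intros j Hj; apply H; lia.
    + rewrite IH, (H (S N)) by lia. ring.
Qed.

Lemma delta_cons i b j a :
  delta (i :: b) (j :: a) = if Nat.eq_dec j i then delta b a else 0.
Proof.
  unfold delta. destruct (list_eq_dec Nat.eq_dec (j :: a) (i :: b)) as [E|E].
  - injection E as -> ->. destruct (Nat.eq_dec i i) as [_|]; [|congruence].
    destruct (list_eq_dec Nat.eq_dec b b); congruence.
  - destruct (Nat.eq_dec j i) as [->|]; [|reflexivity].
    destruct (list_eq_dec Nat.eq_dec a b); congruence.
Qed.

(** An inequality only, since [b] may lie outside the box of size [N]. The norm bound of a monomial
    is needed for every [N], its value only for large [N]. *)
Lemma box_sum_delta_le k N b F :
  (forall a, 0 <= F a) -> box_sum k N (fun a => delta b a * F a) <= F b.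
Proof.
  revert b F; induction k as [|k IH]; intros b F H; simpl.
  - unfold delta. destruct (list_eq_dec Nat.eq_dec nil b) as [<-|].
    + lra.
    + specialize (H b); lra.
  - destruct b as [|i b].
    + rewrite (sum_eq _ (fun _ => 0)); [rewrite sum_cte; specialize (H nil); lra|].
      intros j _. rewrite (box_sum_ext _ _ _ (fun _ => 0)); [apply box_sum_0|].
      intros a _. unfold delta. destruct (list_eq_dec Nat.eq_dec (j :: a) nil); [discriminate|ring].
    + assert (E : forall j, j <> i -> box_sum k N (fun l => delta (i :: b) (j :: l) * F (j :: l)) = 0).
      { intros j Hj. rewrite (box_sum_ext _ _ _ (fun _ => 0)); [apply box_sum_0|].
        intros a _. rewrite delta_cons. destruct (Nat.eq_dec j i); [contradiction|ring]. }
      assert (E' : box_sum k N (fun l => delta (i :: b) (i :: l) * F (i :: l)) <= F (i :: b)).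
      { eapply Rle_trans; [|apply (IH b (fun l => F (i :: l))); intros; apply H].
        right. apply box_sum_ext. intros a _. rewrite delta_cons.
        destruct (Nat.eq_dec i i); [reflexivity|contradiction]. }
      destruct (Nat.le_gt_cases i N) as [Hi|Hi].
      * now rewrite (sum_f_R0_single _ i).
      * rewrite (sum_eq _ (fun _ => 0)); [rewrite sum_cte; specialize (H (i :: b)); lra|].
        intros j Hj. apply E. lia.
Qed.

Lemma box_sum_delta k b F :
  length b = k -> exists N0, forall N, (N0 <= N)%nat ->
    box_sum k N (fun a => delta b a * F a) = F b.
Proof.
  revert k F; induction b as [|i b IH]; intros k F Hk; destruct k as [|k]; try discriminate Hk.
  - exists 0%nat. intros N _. simpl. unfold delta.
    destruct (list_eq_dec Nat.eq_dec nil nil); [ring|congruence].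
  - injection Hk as Hk. destruct (IH k (fun l => F (i :: l)) Hk) as [N0 HN].
    exists (Nat.max i N0). intros N HNN. simpl. rewrite (sum_f_R0_single _ i); [|lia|].
    + rewrite <- (HN N) by lia. apply box_sum_ext. intros a _. rewrite delta_cons.
      destruct (Nat.eq_dec i i); [reflexivity|contradiction].
    + intros j Hj. rewrite (box_sum_ext _ _ _ (fun _ => 0)); [apply box_sum_0|].
      intros a _. rewrite delta_cons. destruct (Nat.eq_dec j i); [contradiction|ring].
Qed.

Lemma ana_monom k x r b :
  length x = k -> 0 < r -> length b = k ->
  ana k x r (fun y => monom b (vsub y x)) (monom b (repeat r k)).
Proof.
  intros Hx Hr Hb. repeat split; try assumption. exists (delta b). split.
  - intros N. eapply Rle_trans; [|apply (box_sum_delta_le k N b (fun a => monom a (repeat r k)))].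
    + right. apply box_sum_ext. intros a _. f_equal. unfold delta.
      destruct (list_eq_dec Nat.eq_dec a b); [apply Rabs_R1|apply Rabs_R0].
    + intros a. left. now apply monom_repeat_pos.
  - intros y Hy. destruct (box_sum_delta k b (fun a => monom a (vsub y x)) Hb) as [N0 HN].
    intros e He. exists N0. intros N HNN. rewrite HN by lia. rewrite R_dist_eq. exact He.
Qed.

(** The completeness of the l1 norm: the coefficients of the sum are the sums of the coefficients.
    All later closure properties reduce to this one, through [ana_box]. *)
Lemma ana_series k x r (F : nat -> list R -> R) B K G :
  (forall i, ana k x r (F i) (B i)) ->
  (forall N, sum_f_R0 B N <= K) ->
  (forall y, in_ball k x r y -> Un_cv (sum_f_R0 (fun i => F i y)) (G y)) ->
  ana k x r G K.
Proof.
  intros HF HK HG.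
  assert (Hx : length x = k) by apply (HF 0%nat).
  assert (Hr : 0 < r) by apply (HF 0%nat).
  destruct (functional_choice (fun i (c : list nat -> R) =>
    (forall N, box_sum k N (fun a => Rabs (c a) * monom a (repeat r k)) <= B i) /\
    (forall y, in_ball k x r y ->
       Un_cv (fun N => box_sum k N (fun a => c a * monom a (vsub y x))) (F i y)))) as [c Hc].
  { intros i. apply (HF i). }
  (* A single term is at most the norm, so the coefficients at a fixed [a] are absolutely summable,
     with total at most [K] divided by r^|a|. *)
  assert (Hcv : forall a, length a = k ->
            Un_cv (sum_f_R0 (fun i => c i a)) (Series (fun i => c i a))).
  { intros a Ha. assert (Hm := monom_repeat_pos a r k Hr).
    apply (Series_abs_bounded _ (K / monom a (repeat r k))). intros N.
    apply Rmult_le_reg_r with (1 := Hm). unfold Rdiv.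
    rewrite Rmult_assoc, Rinv_l, Rmult_1_r by lra.
    eapply Rle_trans; [|apply (HK N)]. rewrite Rmult_comm, scal_sum. apply sum_Rle. intros i _.
    destruct (box_sum_term k a (fun a => Rabs (c i a) * monom a (repeat r k)) Ha) as [M HM].
    - intros b _. apply Rmult_le_pos; [apply Rabs_pos|left; now apply monom_repeat_pos].
    - eapply Rle_trans; [exact HM|]. apply (proj1 (Hc i)). }
  repeat split; try assumption. exists (fun a => Series (fun i => c i a)). split.
  - intros N. eapply (Un_cv_le (fun L => box_sum k N (fun a =>
      Rabs (sum_f_R0 (fun i => c i a) L) * monom a (repeat r k)))).
    + intros L. eapply Rle_trans; [|apply (HK L)].
      eapply Rle_trans; [|apply sum_Rle; intros i _; apply (proj1 (Hc i) N)].
      rewrite <- box_sum_exchange. apply box_sum_le. intros a _.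
      rewrite <- scal_sum with (x := monom a (repeat r k)), Rmult_comm. apply Rmult_le_compat_l;
        [left; now apply monom_repeat_pos|apply Rsum_abs].
    + apply box_sum_cv. intros a Ha. apply CV_mult; [|apply Un_cv_const].
      apply cv_cvabs, Hcv, Ha.
  - intros y Hy.
    (* The limit in the box size [M] is exchanged with the sum over [i]; [B i] dominates the box
       sums of the [i]-th function for all [M] at once. *)
    apply (tannery (fun M i => box_sum k M (fun a => c i a * monom a (vsub y x)))
             B K (fun i => F i y)).
    + intros M i. eapply Rle_trans; [apply (ana_sum_le k x r); assumption|]. apply (proj1 (Hc i)).
    + exact HK.
    + intros i. now apply (proj2 (Hc i)).
    + intros M. eapply Un_cv_ext; [|apply (box_sum_cv k M (fun L a =>
        sum_f_R0 (fun i => c i a) L * monom a (vsub y x)))].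
      * intros L; simpl. rewrite <- box_sum_exchange. apply box_sum_ext. intros a _.
        rewrite Rmult_comm, scal_sum. reflexivity.
      * intros a Ha. apply CV_mult; [now apply Hcv|apply Un_cv_const].
    + now apply HG.
Qed.

Lemma ana_restrict k x r s F B : 0 < s <= r -> ana k x r F B -> ana k x s F B.
Proof.
  intros Hs (Hx & Hr & c & Hc & HF). split; [exact Hx|split; [lra|]]. exists c; split.
  - intros N. eapply Rle_trans; [|apply (Hc N)]. apply box_sum_le; intros a _.
    apply Rmult_le_compat_l; [apply Rabs_pos|now apply monom_repeat_le].
  - intros y [Hy H]. apply HF. split; [exact Hy|]. intros i Hi. specialize (H i Hi). lra.
Qed.

Lemma ana_sum k x r (F : nat -> list R -> R) B N :
  (forall i, (i <= N)%nat -> ana k x r (F i) (B i)) ->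
  ana k x r (fun y => sum_f_R0 (fun i => F i y) N) (sum_f_R0 B N).
Proof.
  induction N as [|N IH]; intros H; simpl.
  - now apply H.
  - apply (ana_plus k x r (fun y => sum_f_R0 (fun i => F i y) N) (F (S N))).
    + apply IH. intros; apply H; lia.
    + apply H; lia.
Qed.

Lemma ana_box_sum k x r k' (T : list nat -> list R -> R) tau N :
  (forall a, length a = k' -> ana k x r (T a) (tau a)) ->
  ana k x r (fun y => box_sum k' N (fun a => T a y)) (box_sum k' N tau).
Proof.
  revert T tau; induction k' as [|k' IH]; intros T tau H; simpl.
  - now apply (H nil).
  - apply (ana_sum k x r (fun i y => box_sum k' N (fun l => T (i :: l) y))).
    intros i _. apply (IH (fun l => T (i :: l))). intros a Ha. apply H. simpl; lia.
Qed.

(** Splitting by the first index gives lower-dimensional shells for indices up to [N] and one whole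
    box at [S N]. The bound is a difference of [tau]-sums, not a sum of two norms; only so do the
    bounds of consecutive shells telescope. *)
Lemma ana_box_shell k x r k' (T : list nat -> list R -> R) tau N :
  length x = k -> 0 < r ->
  (forall a, length a = k' -> ana k x r (T a) (tau a)) ->
  ana k x r
    (fun y => box_sum k' (S N) (fun a => T a y) - box_sum k' N (fun a => T a y))
    (box_sum k' (S N) tau - box_sum k' N tau).
Proof.
  intros Hx Hr; revert T tau; induction k' as [|k' IH]; intros T tau H; simpl.
  - eapply ana_ext; [|eapply ana_le; [|apply (ana_scal k x r 0), (H nil); reflexivity]].
    + intros y _; simpl; ring.
    + rewrite Rabs_R0. lra.
  - eapply ana_ext; [|eapply ana_le; [|apply ana_plus; [apply (ana_sum k x r
      (fun i y => box_sum k' (S N) (fun l => T (i :: l) y) -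
                  box_sum k' N (fun l => T (i :: l) y))
      (fun i => box_sum k' (S N) (fun l => tau (i :: l)) -
                box_sum k' N (fun l => tau (i :: l))) N)|
      apply (ana_box_sum k x r k' (fun l => T (S N :: l)) (fun l => tau (S N :: l)) (S N))]]].
    + intros y _; simpl. rewrite minus_sum. ring.
    + rewrite minus_sum. right; ring.
    + intros i _. apply (IH (fun l => T (i :: l))). intros a Ha. apply H. simpl; lia.
    + intros a Ha. apply H. simpl; lia.
Qed.

(* The box sums are turned into a series by telescoping over the shells
   between consecutive boxes. *)
Lemma ana_box k x r k' (T : list nat -> list R -> R) tau F B :
  length x = k -> 0 < r ->
  (forall a, length a = k' -> ana k x r (T a) (tau a)) ->
  (forall N, box_sum k' N tau <= B) ->
  (forall y, in_ball k x r y -> Un_cv (fun N => box_sum k' N (fun a => T a y)) (F y)) ->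
  ana k x r F B.
Proof.
  intros Hx Hr HT Hb HF.
  apply (ana_series k x r
    (fun i y => match i with
      | O => box_sum k' 0 (fun a => T a y)
      | S i => box_sum k' (S i) (fun a => T a y) - box_sum k' i (fun a => T a y)
      end)
    (fun i => match i with
      | O => box_sum k' 0 tau
      | S i => box_sum k' (S i) tau - box_sum k' i tau
      end)).
  - intros [|i].
    + now apply ana_box_sum.
    + now apply ana_box_shell.
  - intros N. eapply Rle_trans; [right|apply (Hb N)].
    induction N as [|N IH]; simpl; [reflexivity|]. rewrite IH. ring.
  - intros y Hy. eapply Un_cv_ext; [|apply HF, Hy]. intros N; simpl.
    induction N as [|N IH]; simpl; [reflexivity|]. rewrite <- IH. ring.
Qed.

(** * Products *)

Fixpoint madd (a b : list nat) : list nat :=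
  match a, b with
  | i :: a', j :: b' => (i + j)%nat :: madd a' b'
  | _, _ => nil
  end.

Lemma madd_length a b : length a = length b -> length (madd a b) = length a.
Proof.
  revert b; induction a as [|i a IH]; intros [|j b] H; try discriminate H; simpl; auto.
Qed.

Lemma monom_madd a b d :
  length a = length b -> monom (madd a b) d = monom a d * monom b d.
Proof.
  revert b d; induction a as [|i a IH]; intros [|j b] d H; try discriminate H; simpl.
  - ring.
  - destruct d as [|t d]; [ring|]. rewrite pow_add, IH by auto. ring.
Qed.

Lemma ana_monom_mult k x r b G C :
  length b = k -> ana k x r G C ->
  ana k x r (fun y => monom b (vsub y x) * G y) (monom b (repeat r k) * C).
Proof.
  intros Hb (Hx & Hr & c & Hc & HG).
  assert (Hp := monom_repeat_pos b r k Hr).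
  apply (ana_box k x r k (fun a y => c a * monom (madd b a) (vsub y x))
           (fun a => monom b (repeat r k) * (Rabs (c a) * monom a (repeat r k))));
    try assumption.
  - intros a Ha. eapply ana_le; [|apply ana_scal, ana_monom; try assumption].
    + rewrite monom_madd by lia. right; ring.
    + rewrite madd_length; lia.
  - intros N. rewrite box_sum_scal. apply Rmult_le_compat_l; [lra|apply Hc].
  - intros y Hy. eapply Un_cv_ext; [|apply Un_cv_scal, HG, Hy]. intros N; simpl.
    rewrite <- box_sum_scal. apply box_sum_ext. intros a Ha.
    rewrite monom_madd by lia. ring.
Qed.

(** Only [F] is expanded while [G] is kept whole, so no Cauchy product has to be formed: each term
    is a monomial times [G], where exponents merely shift. *)
Lemma ana_mult k x r F G B C :
  ana k x r F B -> ana k x r G C -> ana k x r (fun y => F y * G y) (B * C).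
Proof.
  intros (Hx & Hr & c & Hc & HF) HG. assert (HC := ana_bound_pos _ _ _ _ _ HG).
  apply (ana_box k x r k (fun a y => c a * (monom a (vsub y x) * G y))
           (fun a => C * (Rabs (c a) * monom a (repeat r k)))); try assumption.
  - intros a Ha. eapply ana_le; [|apply ana_scal, ana_monom_mult; eassumption].
    right; ring.
  - intros N. rewrite box_sum_scal, (Rmult_comm B). apply Rmult_le_compat_l; [lra|apply Hc].
  - intros y Hy. rewrite Rmult_comm. eapply Un_cv_ext; [|apply Un_cv_scal, HF, Hy].
    intros N; simpl. rewrite <- box_sum_scal. apply box_sum_ext. intros a Ha. ring.
Qed.

Lemma monom_0 a d : list_sum a = 0%nat -> monom a d = 1.
Proof.
  revert d; induction a as [|i a IH]; intros [|t d] H; simpl in *; try reflexivity.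
  replace i with 0%nat by lia. rewrite IH by lia. simpl; ring.
Qed.

Lemma monom_zeros a x : list_sum a <> 0%nat -> length x = length a -> monom a (vsub x x) = 0.
Proof.
  revert x; induction a as [|i a IH]; intros [|t x] H Hl; simpl in *; try discriminate Hl;
    try lia.
  destruct i as [|i]; simpl.
  - rewrite IH by lia. ring.
  - ring.
Qed.

Lemma monom_scale a s r k :
  length a = k -> monom a (repeat (s * r) k) = s ^ list_sum a * monom a (repeat r k).
Proof.
  revert k; induction a as [|i a IH]; intros [|k] H; try discriminate H; simpl.
  - ring.
  - rewrite IH by auto. rewrite pow_add, Rpow_mult_distr. ring.
Qed.

Lemma ana_const k x r s : length x = k -> 0 < r -> ana k x r (fun _ => s) (Rabs s).
Proof.
  intros Hx Hr.
  assert (E : list_sum (repeat 0%nat k) = 0%nat) by (clear; induction k; simpl; auto).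
  eapply ana_ext; [|eapply ana_le; [|apply (ana_scal k x r s), ana_monom; try assumption;
    apply (repeat_length 0%nat)]].
  - intros y _; simpl. rewrite monom_0 by exact E. ring.
  - rewrite monom_0 by exact E. lra.
Qed.

Lemma ana_one k x r : length x = k -> 0 < r -> ana k x r (fun _ => 1) 1.
Proof.
  intros Hx Hr. apply (ana_le _ _ _ _ (Rabs 1)); [rewrite Rabs_R1; lra|]. now apply ana_const.
Qed.

Lemma monom_single i k :
  (i < k)%nat -> exists b, length b = k /\ forall d, length d = k -> monom b d = nth i d 0.
Proof.
  revert i; induction k as [|k IH]; intros i Hi; [lia|]. destruct i as [|i].
  - exists (1%nat :: repeat 0%nat k). split; [simpl; now rewrite repeat_length|].
    intros [|t d] Hd; try discriminate Hd. simpl. rewrite monom_0; [ring|].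
    clear; induction k; simpl; auto.
  - destruct (IH i ltac:(lia)) as [b [Hb E]]. exists (0%nat :: b). split; [simpl; lia|].
    intros [|t d] Hd; try discriminate Hd. simpl. rewrite E by auto. ring.
Qed.

Lemma ana_coord k x r i :
  length x = k -> 0 < r -> (i < k)%nat ->
  ana k x r (fun y => nth i y 0 - nth i x 0) r.
Proof.
  intros Hx Hr Hi. destruct (monom_single i k Hi) as [b [Hb E]].
  eapply ana_ext; [|eapply ana_le; [|apply (ana_monom k x r b); assumption]].
  - intros y [Hy _]; simpl. rewrite E by (rewrite vsub_length; lia). apply vsub_nth; lia.
  - rewrite E by apply repeat_length. rewrite nth_repeat_lt by exact Hi. lra.
Qed.

Lemma ana_pow k x r F B n :
  ana k x r F B -> ana k x r (fun y => F y ^ n) (B ^ n).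
Proof.
  intros H; induction n as [|n IH]; simpl.
  - apply ana_one; apply H.
  - now apply ana_mult.
Qed.

(** * Composition and its Lipschitz estimate *)

Lemma ana_monom_comp k x r ds s a :
  length x = k -> 0 < r -> Forall (fun F => ana k x r F s) ds ->
  ana k x r (fun y => monom a (map (fun F => F y) ds)) (monom a (repeat s (length ds))).
Proof.
  intros Hx Hr H; revert a; induction H as [|F ds HF _ IH]; intros [|i a]; simpl;
    try now apply ana_one.
  apply (ana_mult k x r (fun y => F y ^ i)); [now apply ana_pow|apply IH].
Qed.

(** By p^(n+1) - q^(n+1) = p (p^n - q^n) + (p - q) q^n. Measuring the distance relative to the size
    [s] keeps the full power [s ^ n] in the bound and avoids the exponent n - 1. *)
Lemma ana_pow_diff k x r p q s e n :
  ana k x r p s -> ana k x r q s -> ana k x r (fun y => p y - q y) (s * e) ->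
  ana k x r (fun y => p y ^ n - q y ^ n) (e * INR n * s ^ n).
Proof.
  intros Hp Hq Hd; induction n as [|n IH]; cbn [pow].
  - eapply ana_ext; [|eapply ana_le; [|apply (ana_const k x r 0); apply Hp]].
    + intros y _; simpl; ring.
    + rewrite Rabs_R0. simpl; lra.
  - eapply ana_ext; [|eapply ana_le; [|apply ana_plus; [apply ana_mult; [exact Hp|exact IH]|
      apply ana_mult; [exact Hd|apply (ana_pow _ _ _ _ _ n Hq)]]]].
    + intros y _; simpl; ring.
    + rewrite S_INR. right; ring.
Qed.

(** The product rule over the factors of the monomial: each variable contributes its exponent, which
    adds up to the total degree [list_sum a]. *)
Lemma ana_monom_diff k x r ps qs s e a :
  length x = k -> 0 < r ->
  Forall2 (fun p q => ana k x r p s /\ ana k x r q s /\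
                      ana k x r (fun y => p y - q y) (s * e)) ps qs ->
  length a = length ps ->
  ana k x r (fun y => monom a (map (fun F => F y) ps) - monom a (map (fun F => F y) qs))
    (e * INR (list_sum a) * monom a (repeat s (length ps))).
Proof.
  intros Hx Hr H; revert a; induction H as [|p q ps qs [Hp [Hq Hd]] H IH]; intros [|i a] Ha;
    try discriminate Ha; cbn [map monom length repeat].
  - eapply ana_ext; [|eapply ana_le; [|apply (ana_const k x r 0); assumption]].
    + intros y _; simpl; ring.
    + rewrite Rabs_R0. simpl; lra.
  - assert (Hps : Forall (fun F => ana k x r F s) ps).
    { clear -H. induction H as [|p q ps qs Hpq _ IH]; constructor; tauto. }
    assert (Hqs : Forall (fun F => ana k x r F s) qs).
    { clear -H. induction H as [|p q ps qs Hpq _ IH]; constructor; tauto. }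
    eapply ana_ext; [|eapply ana_le; [|apply ana_plus; [apply ana_mult;
      [apply (ana_pow _ _ _ _ _ i Hp)|apply (IH a); auto]|
      apply ana_mult; [apply (ana_pow_diff _ _ _ _ _ _ _ i Hp Hq Hd)|
        apply (ana_monom_comp k x r qs s a); assumption]]]].
    + intros y _; simpl; ring.
    + rewrite <- (Forall2_length H). cbn [list_sum fold_right].
      change (fold_right Nat.add 0%nat a) with (list_sum a). rewrite plus_INR. right; ring.
Qed.

Lemma vsub_map_seq k p (z : list R) :
  length p = k -> length z = k ->
  vsub p z = map (fun i => nth i p 0 - nth i z 0) (seq 0 k).
Proof.
  intros Hp Hz. apply nth_ext with (d := 0) (d' := 0).
  - rewrite length_map, length_seq, vsub_length; lia.
  - intros i Hi. rewrite vsub_length in Hi by lia. rewrite vsub_nth by lia.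
    rewrite (nth_indep (map _ _) 0 ((fun i => nth i p 0 - nth i z 0) 0%nat))
      by (rewrite length_map, length_seq; lia).
    rewrite (map_nth (fun i => nth i p 0 - nth i z 0)), seq_nth by lia. reflexivity.
Qed.

(** Substituting functions of norm at most [s] into a monomial gives norm at most s^|a|, so the
    bound [B] of [G] passes on unchanged. The strict [s < r'] keeps [P y] in the open polydisc where
    the series of [G] is known to converge to it. *)
Lemma ana_comp k x r k' z r' G B s P :
  ana k' z r' G B -> length x = k -> 0 < r -> 0 < s < r' ->
  (forall y, in_ball k x r y -> length (P y) = k') ->
  (forall i, (i < k')%nat -> ana k x r (fun y => nth i (P y) 0 - nth i z 0) s) ->
  ana k x r (fun y => G (P y)) B.
Proof.
  intros (Hz & Hr' & c & Hc & HG) Hx Hr Hs HPl HP.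
  set (ds := map (fun i y => nth i (P y) 0 - nth i z 0) (seq 0 k')).
  assert (Hds : Forall (fun F => ana k x r F s) ds).
  { apply Forall_forall. intros F HF. apply in_map_iff in HF as [i [<- Hi]].
    apply in_seq in Hi. apply HP. lia. }
  assert (Hlen : length ds = k') by (unfold ds; now rewrite length_map, length_seq).
  apply (ana_box k x r k' (fun a y => c a * monom a (map (fun F => F y) ds))
    (fun a => Rabs (c a) * monom a (repeat s k'))); try assumption.
  - intros a _. rewrite <- Hlen. now apply ana_scal, ana_monom_comp.
  - intros N. eapply Rle_trans; [|apply (Hc N)]. apply box_sum_le. intros a _.
    apply Rmult_le_compat_l; [apply Rabs_pos|apply monom_repeat_le; lra].
  - intros y Hy. eapply Un_cv_ext; [|apply HG].
    + intros N; simpl. apply box_sum_ext. intros a _. do 2 f_equal.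
      rewrite (vsub_map_seq k') by auto. unfold ds. rewrite map_map. reflexivity.
    + split; [now apply HPl|]. intros i Hi. eapply Rle_lt_trans; [|apply (proj2 Hs)].
      apply (ana_bound _ _ _ _ _ y (HP i Hi) Hy).
Qed.

Lemma INR_le_pow2 n : INR n <= 2 ^ n.
Proof.
  induction n as [|n IH]; [simpl; lra|]. rewrite S_INR. cbn [pow].
  assert (1 <= 2 ^ n) by (apply pow_R1_Rle; lra). lra.
Qed.

(* Halving the radius absorbs the factor [|a|] produced by differencing the
   monomial of exponent [a], as [|a| <= 2 ^ |a|]. *)
Lemma ana_comp_lipschitz k x r k' z s G B e P Q :
  ana k' z (2 * s) G B -> length x = k -> 0 < r -> 0 <= e ->
  (forall y, in_ball k x r y -> length (P y) = k' /\ length (Q y) = k') ->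
  (forall i, (i < k')%nat ->
     ana k x r (fun y => nth i (P y) 0 - nth i z 0) s /\
     ana k x r (fun y => nth i (Q y) 0 - nth i z 0) s /\
     ana k x r (fun y => nth i (P y) 0 - nth i (Q y) 0) (s * e)) ->
  ana k x r (fun y => G (P y) - G (Q y)) (e * B).
Proof.
  intros (Hz & Hr' & c & Hc & HG) Hx Hr He Hl HPQ.
  set (ps := map (fun i y => nth i (P y) 0 - nth i z 0) (seq 0 k')).
  set (qs := map (fun i y => nth i (Q y) 0 - nth i z 0) (seq 0 k')).
  assert (Hlen : length ps = k') by (unfold ps; now rewrite length_map, length_seq).
  assert (Hpq : Forall2 (fun p q => ana k x r p s /\ ana k x r q s /\
                      ana k x r (fun y => p y - q y) (s * e)) ps qs).
  { unfold ps, qs. assert (Hi : forall i, In i (seq 0 k') -> (i < k')%nat).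
    { intros i Hi; apply in_seq in Hi; lia. }
    revert Hi. generalize (seq 0 k') as l. intros l; induction l as [|i l IH]; intros Hi;
      simpl; constructor.
    - destruct (HPQ i (Hi i (or_introl eq_refl))) as (H1 & H2 & H3).
      split; [exact H1|split; [exact H2|]]. eapply ana_ext; [|exact H3].
      intros y _; simpl; ring.
    - apply IH. intros j Hj; apply Hi; now right. }
  assert (Hball : forall U y, (forall i, (i < k')%nat ->
      ana k x r (fun y => nth i (U y) 0 - nth i z 0) s) ->
      in_ball k x r y -> length (U y) = k' -> in_ball k' z (2 * s) (U y)).
  { intros U y HU Hy HUy. split; [exact HUy|]. intros i Hi.
    eapply Rle_lt_trans; [apply (ana_bound _ _ _ _ _ y (HU i Hi) Hy)|lra]. }
  apply (ana_box k x r k'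
    (fun a y => c a * (monom a (map (fun F => F y) ps) - monom a (map (fun F => F y) qs)))
    (fun a => e * (Rabs (c a) * monom a (repeat (2 * s) k')))); try assumption.
  - intros a Ha. eapply ana_le; [|apply ana_scal; refine (ana_monom_diff _ _ _ _ _ _ _ a _ _ Hpq _);
      congruence || assumption].
    rewrite Hlen, monom_scale by exact Ha.
    assert (H1 := INR_le_pow2 (list_sum a)).
    assert (H2 : 0 < monom a (repeat s k')) by (apply monom_repeat_pos; lra).
    assert (H3 := Rabs_pos (c a)). 
    replace (e * (Rabs (c a) * (2 ^ list_sum a * monom a (repeat s k'))))
      with (Rabs (c a) * (e * 2 ^ list_sum a * monom a (repeat s k'))) by ring.
    apply Rmult_le_compat_l; [exact H3|]. apply Rmult_le_compat_r; [lra|].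
    apply Rmult_le_compat_l; assumption.
  - intros N. rewrite box_sum_scal. apply Rmult_le_compat_l; [exact He|apply Hc].
  - intros y Hy. destruct (Hl y Hy) as [HlP HlQ].
    eapply Un_cv_ext; [|apply CV_minus; apply HG].
    + intros N; simpl.
      transitivity (box_sum k' N (fun a => c a * monom a (vsub (P y) z)) +
        -1 * box_sum k' N (fun a => c a * monom a (vsub (Q y) z))); [ring|].
      rewrite <- box_sum_scal, <- box_sum_plus.
      apply box_sum_ext. intros a _.
      rewrite !(vsub_map_seq k') by auto. unfold ps, qs. rewrite !map_map. ring.
    + apply Hball; auto. intros i Hi; apply (HPQ i Hi).
    + apply Hball; auto. intros i Hi; apply (HPQ i Hi).
Qed.

(** A Schwarz-type estimate: subtracting [F x] removes the constant term, and every monomial of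
    positive degree gains at least a factor [t] when the radius is scaled by [t]. *)
Lemma ana_shrink k x r t F B :
  0 < t <= 1 -> ana k x r F B -> ana k x (t * r) (fun y => F y - F x) (t * B).
Proof.
  intros Ht (Hx & Hr & c & Hc & HF).
  assert (Htr : 0 < t * r <= r).
  { split; [apply Rmult_lt_0_compat; lra|]. rewrite <- (Rmult_1_l r) at 2.
    apply Rmult_le_compat_r; lra. }
  apply (ana_box k x (t * r) k
    (fun a y => c a * (monom a (vsub y x) - monom a (vsub x x)))
    (fun a => t * (Rabs (c a) * monom a (repeat r k)))); [exact Hx|lra|..].
  - intros a Ha. assert (Hm := monom_repeat_pos a r k Hr). assert (H3 := Rabs_pos (c a)).
    destruct (Nat.eq_dec (list_sum a) 0) as [E|E].
    + eapply ana_ext; [|eapply ana_le; [|apply (ana_const k x (t * r) 0); [assumption|lra]]].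
      * intros y _; simpl. rewrite !monom_0 by exact E. ring.
      * rewrite Rabs_R0. apply Rmult_le_pos; [lra|]. apply Rmult_le_pos; lra.
    + eapply ana_ext; [|eapply ana_le; [|apply (ana_scal k x (t * r) (c a)), (ana_monom _ _ _ a);
        [assumption|lra|exact Ha]]].
      * intros y _; simpl. rewrite (monom_zeros a x) by congruence. ring.
      * rewrite monom_scale by exact Ha.
        replace (t * (Rabs (c a) * monom a (repeat r k))) with
          (Rabs (c a) * (t * monom a (repeat r k))) by ring.
        apply Rmult_le_compat_l; [exact H3|]. apply Rmult_le_compat_r; [lra|].
        destruct (list_sum a) as [|p]; [contradiction|]. simpl.
        apply Rle_trans with (t * 1); [|lra]. apply Rmult_le_compat_l; [lra|].
        rewrite <- (pow1 p). apply pow_incr; lra.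
  - intros N. rewrite box_sum_scal. apply Rmult_le_compat_l; [lra|apply Hc].
  - intros y [Hy Hb]. eapply Un_cv_ext; [|apply CV_minus; apply HF].
    + intros N; simpl.
      transitivity (box_sum k N (fun a => c a * monom a (vsub y x)) +
        -1 * box_sum k N (fun a => c a * monom a (vsub x x))); [ring|].
      rewrite <- box_sum_scal, <- box_sum_plus.
      apply box_sum_ext. intros a _. ring.
    + split; [exact Hy|]. intros i Hi; specialize (Hb i Hi); lra.
    + now apply in_ball_center.
Qed.

(** * Integration in the first variable *)

Lemma is_RInt_box_sum k N (T : list nat -> R -> R) (I : list nat -> R) a b :
  (forall l, length l = k -> is_RInt (T l) a b (I l)) ->
  is_RInt (fun t => box_sum k N (fun l => T l t)) a b (box_sum k N I).
Proof.
  revert T I; induction k as [|k IH]; intros T I H; simpl.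
  - now apply H.
  - assert (H' : forall i, is_RInt (fun t => box_sum k N (fun l => T (i :: l) t)) a b
                   (box_sum k N (fun l => I (i :: l)))).
    { intros i. apply (IH (fun l => T (i :: l))). intros l Hl; apply H; simpl; lia. }
    (* The outer summation bound is separated from the inner box size, so that induction on it
       leaves the inner boxes fixed. *)
    generalize N at 2 4 as M. intros M; induction M as [|M IHM]; simpl.
    + apply H'.
    + apply (is_RInt_plus (V := R_NormedModule)); [exact IHM|apply H'].
Qed.

Lemma is_RInt_shift_pow s n a b :
  is_RInt (fun t => (t - s) ^ n) a b (((b - s) ^ S n - (a - s) ^ S n) / INR (S n)).
Proof.
  assert (HS : INR (S n) <> 0) by (apply not_0_INR; lia).
  replace (((b - s) ^ S n - (a - s) ^ S n) / INR (S n)) with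
    (minus ((b - s) ^ S n / INR (S n)) ((a - s) ^ S n / INR (S n)) : R)
    by (unfold minus, plus, opp; simpl; field; exact HS).
  apply (is_RInt_derive (fun t => (t - s) ^ S n / INR (S n))).
  - intros t _. auto_derive; [exact I|]. fold (INR (S n)). unfold Rminus. field. exact HS.
  - intros t _. apply (ex_derive_continuous (fun t => (t - s) ^ n)). auto_derive. exact I.
Qed.

(** The error [eps N] is the tail of the norm series, so it does not depend on [y]. This uniform
    convergence justifies integrating term by term. *)
Lemma ana_remainder k x r F B :
  ana k x r F B -> exists c eps,
    (forall N, box_sum k N (fun a => Rabs (c a) * monom a (repeat r k)) <= B) /\
    Un_cv eps 0 /\
    forall y, in_ball k x r y -> forall N,
      Rabs (box_sum k N (fun a => c a * monom a (vsub y x)) - F y) <= eps N.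
Proof.
  intros (Hx & Hr & c & Hc & HF).
  set (tau := fun a => Rabs (c a) * monom a (repeat r k)) in *.
  assert (Htau : forall a, 0 <= tau a).
  { intros a. apply Rmult_le_pos; [apply Rabs_pos|left; now apply monom_repeat_pos]. }
  destruct (ex_finite_lim_seq_incr (fun N => box_sum k N tau) B) as [Binf HB];
    [intros N; now apply box_sum_mono|exact Hc|]. apply is_lim_seq_Reals in HB.
  exists c, (fun N => Binf - box_sum k N tau). split; [exact Hc|split].
  - replace 0 with (Binf - Binf) by ring. apply CV_minus; [apply Un_cv_const|exact HB].
  - intros y Hy N. rewrite Rabs_minus_sym.
    set (T := fun a => c a * monom a (vsub y x)).
    assert (HT : forall a, length a = k -> Rabs (T a) <= tau a).
    { intros a Ha. unfold T, tau. rewrite Rabs_mult.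
      apply Rmult_le_compat_l; [apply Rabs_pos|now apply ana_term_le]. }
    apply (Un_cv_abs_le (fun M => box_sum k (M + N) T - box_sum k N T)).
    + intros M. assert (H1 : box_sum k (M + N) tau <= Binf).
      { apply (growing_ineq (fun N => box_sum k N tau)); [|exact HB].
        intros n; now apply box_sum_mono. }
      (* Both [tau + T] and [tau - T] are nonnegative, so their box sums increase with the box. The
         two inequalities bound the change in the sum of [T] by that of [tau], without summing over
         the complement of a box. *)
      assert (H2 : box_sum k N (fun a => tau a + T a) <= box_sum k (M + N) (fun a => tau a + T a)).
      { apply box_sum_mono_le; [|lia]. intros a Ha. specialize (HT a Ha).
        apply Rabs_le_between in HT; lra. }
      assert (H3 : box_sum k N (fun a => tau a + -1 * T a) <=
                   box_sum k (M + N) (fun a => tau a + -1 * T a)).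
      { apply box_sum_mono_le; [|lia]. intros a Ha. specialize (HT a Ha).
        apply Rabs_le_between in HT; lra. }
      rewrite !box_sum_plus in H2, H3. rewrite !box_sum_scal in H3.
      apply Rabs_le_between. lra.
    + apply CV_minus; [|apply Un_cv_const]. intros e He. destruct (HF y Hy e He) as [M0 HM].
      exists M0. intros M HMM. apply HM. lia.
Qed.

Lemma Rabs_between s a b t r :
  Rabs (a - s) < r -> Rabs (b - s) < r -> Rmin a b <= t <= Rmax a b -> Rabs (t - s) < r.
Proof.
  intros Ha Hb Ht. apply Rabs_def2 in Ha, Hb.
  unfold Rmin, Rmax in Ht. destruct (Rle_dec a b); apply Rabs_def1; lra.
Qed.

(** The lower limit [sg] may differ from the centre [s]. A power i of time integrates to two powers
    i + 1 divided by i + 1, each at most r^(i+1) in size: hence the factor [2 * r], which is small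
    on small polydiscs. *)
Lemma ana_int k s z r F B sg :
  ana (S k) (s :: z) r F B -> Rabs (sg - s) < r ->
  (forall t y, in_ball (S k) (s :: z) r (t :: y) -> ex_RInt (fun u => F (u :: y)) sg t) /\
  ana (S k) (s :: z) r (fun y => RInt (fun u => F (u :: tl y)) sg (hd 0 y)) (2 * r * B).
Proof.
  intros HF Hsg. assert (Hx : length (s :: z) = S k) by apply HF.
  assert (Hr : 0 < r) by apply HF.
  destruct (ana_remainder _ _ _ _ _ HF) as (c & eps & Hc & Heps & Hrem).
  set (T := fun (a : list nat) (y : list R) =>
    c a * (((hd 0 y - s) ^ S (hd 0%nat a) - (sg - s) ^ S (hd 0%nat a)) / INR (S (hd 0%nat a))
           * monom (tl a) (vsub (tl y) z))).
  assert (Hlim : forall t y, in_ball (S k) (s :: z) r (t :: y) -> exists I,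
      Un_cv (fun N => box_sum (S k) N (fun a => T a (t :: y))) I /\
      is_RInt (fun u => F (u :: y)) sg t I).
  { intros t y [Hy Hty].
    (* [filterlim_RInt] asks for uniform convergence over all real [u]. Clamping [u] to the interval
       of integration provides it and leaves the integrals unchanged. *)
    set (cl := fun u => Rmax (Rmin sg t) (Rmin u (Rmax sg t))).
    assert (Hcl : forall u, Rmin sg t <= u <= Rmax sg t -> cl u = u).
    { intros u Hu. unfold cl. rewrite (Rmin_left u) by lra. rewrite Rmax_right; lra. }
    assert (Hmm : Rmin sg t <= Rmax sg t).
    { eapply Rle_trans; [apply Rmin_l|apply Rmax_l]. }
    assert (Hclb : forall u, Rmin sg t <= cl u <= Rmax sg t).
    { intros u. unfold cl. split; [apply Rmax_l|]. apply Rmax_lub; [exact Hmm|apply Rmin_r]. }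
    assert (Hb : forall u, in_ball (S k) (s :: z) r (cl u :: y)).
    { intros u. split; [exact Hy|]. intros [|i] Hi; [|apply (Hty (S i) Hi)]. simpl.
      apply (Rabs_between s sg t); [exact Hsg|apply (Hty 0%nat Hi)|apply Hclb]. }
    destruct (filterlim_RInt (V := R_CompleteNormedModule)
      (fun N u => box_sum (S k) N (fun a => c a * monom a (vsub (cl u :: y) (s :: z))))
      sg t eventually _ (fun u => F (cl u :: y))
      (fun N => box_sum (S k) N (fun a => T a (t :: y)))) as [I [HI1 HI2]].
    - intros N. apply (is_RInt_ext (V := R_NormedModule)
        (fun u => box_sum (S k) N (fun a => c a * monom a (vsub (u :: y) (s :: z))))).
      { intros u Hu. rewrite Hcl by lra. reflexivity. }
      apply (is_RInt_box_sum (S k) N (fun a u => c a * monom a (vsub (u :: y) (s :: z)))).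
      intros [|i a] Ha; [discriminate Ha|]. unfold T; simpl hd; simpl tl.
      apply (is_RInt_scal (V := R_NormedModule)). cbn [vsub monom].
      rewrite Rmult_comm.
      apply (is_RInt_ext (V := R_NormedModule) (fun u => monom a (vsub y z) * (u - s) ^ i)).
      { intros; apply Rmult_comm. }
      apply (is_RInt_scal (V := R_NormedModule)), is_RInt_shift_pow.
    - intros P [e He]. destruct (Heps e (cond_pos e)) as [N0 HN].
      exists N0. intros N HNN. apply He. intros u.
      unfold ball; simpl. unfold AbsRing_ball, abs, minus, plus, opp; simpl.
      specialize (HN N HNN). unfold Rdist in HN. rewrite Rminus_0_r in HN.
      eapply Rle_lt_trans; [apply (Hrem _ (Hb u) N)|].
      eapply Rle_lt_trans; [apply Rle_abs|exact HN].
    - exists I. split; [now apply is_lim_seq_Reals|].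
      apply (is_RInt_ext (V := R_NormedModule)) with (2 := HI2).
      intros u Hu. rewrite Hcl by lra. reflexivity. }
  split.
  - intros t y Hy. destruct (Hlim t y Hy) as [I [_ HI]]. now exists I.
  - apply (ana_box _ _ _ (S k) T
      (fun a => 2 * r * (Rabs (c a) * monom a (repeat r (S k))))); try assumption.
    + intros [|i a] Ha; [discriminate Ha|]. injection Ha as Ha.
      assert (HS : 1 <= INR (S i)).
      { change 1 with (INR 1). apply le_INR. lia. }
      assert (Hm := monom_repeat_pos a r k Hr). assert (H3 := Rabs_pos (c (i :: a))).
      assert (Hp := pow_lt r (S i) Hr).
      (* The upper limit gives the monomial with time exponent [S i]; the lower limit gives the one
         with time exponent 0, times the constant [(sg - s) ^ S i]. *)
      eapply ana_ext; [|eapply ana_le; [|apply (ana_scal _ _ _ (c (i :: a) / INR (S i))),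
        ana_minus; [apply (ana_monom _ _ _ (S i :: a))|
          apply (ana_scal _ _ _ ((sg - s) ^ S i)), (ana_monom _ _ _ (0%nat :: a))];
          simpl; auto]].
      * intros [|t y] [Hy _]; [discriminate Hy|]. unfold T. cbn [hd tl vsub monom].
        rewrite pow_O. field. lra.
      * unfold Rdiv. rewrite Rabs_mult, Rabs_inv, (Rabs_pos_eq (INR (S i))) by lra.
        cbn [repeat monom]. rewrite pow_O.
        assert (H4 : Rabs ((sg - s) ^ S i) <= r ^ S i).
        { rewrite <- RPow_abs. apply pow_incr. split; [apply Rabs_pos|lra]. }
        apply Rle_trans with (Rabs (c (i :: a)) * 1 * (2 * (r ^ S i * monom a (repeat r k)))).
        -- apply Rmult_le_compat.
           ++ apply Rmult_le_pos; [exact H3|]. left; apply Rinv_0_lt_compat; lra.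
           ++ apply Rplus_le_le_0_compat; [apply Rmult_le_pos; lra|].
              apply Rmult_le_pos; [apply Rabs_pos|lra].
           ++ apply Rmult_le_compat_l; [exact H3|]. rewrite <- Rinv_1.
              apply Rinv_le_contravar; lra.
           ++ assert (Rabs ((sg - s) ^ S i) * monom a (repeat r k) <=
                      r ^ S i * monom a (repeat r k)) by (apply Rmult_le_compat_r; lra).
              lra.
        -- cbn [pow]. right; ring.
    + intros N. rewrite box_sum_scal. apply Rmult_le_compat_l; [lra|apply Hc].
    + intros [|t y] Hy; [destruct Hy as [Hy _]; discriminate Hy|].
      destruct (Hlim t y Hy) as [I [HI1 HI2]]. cbn [hd tl].
      rewrite (is_RInt_unique (V := R_CompleteNormedModule) _ _ _ _ HI2). exact HI1.
Qed.

(** * Local solutions by Picard iteration *)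

Definition vec (n : nat) (U : nat -> list R -> R) (x : list R) : list R :=
  map (fun j => U j x) (seq 0 n).

Lemma vec_length n U x : length (vec n U x) = n.
Proof. unfold vec. now rewrite length_map, length_seq. Qed.

Lemma vec_nth n U x j : (j < n)%nat -> nth j (vec n U x) 0 = U j x.
Proof.
  intros Hj. rewrite (nth_indep _ 0 ((fun j => U j x) 0%nat)) by (rewrite vec_length; lia).
  unfold vec. rewrite (map_nth (fun j => U j x)), seq_nth by lia. reflexivity.
Qed.

(* The time variable comes first, so that it is integrated by [ana_int]: the
   unknown is a function of [t :: v ++ y], where [y] is the initial value,
   and [field_arg] lists the arguments of the vector field in the order [v, t, u]. *)
Definition field_arg (m n : nat) (U : nat -> list R -> R) (x : list R) : list R :=
  firstn m (tl x) ++ hd 0 x :: vec n U x.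

Lemma field_arg_app m n U t v y :
  length v = m -> field_arg m n U (t :: v ++ y) = v ++ t :: vec n U (t :: v ++ y).
Proof.
  intros Hv. unfold field_arg. cbn [hd tl].
  rewrite firstn_app, Hv, Nat.sub_diag, <- Hv, firstn_all. simpl. now rewrite app_nil_r.
Qed.

Lemma field_arg_length m n U x :
  length x = S (m + n) -> length (field_arg m n U x) = (m + 1 + n)%nat.
Proof.
  intros Hx. destruct x as [|t x]; [discriminate Hx|]. injection Hx as Hx.
  unfold field_arg. simpl. rewrite length_app, length_firstn. simpl. rewrite vec_length. lia.
Qed.

(** An argument of the vector field is either a coordinate of [x], the same for all iterates, or a
    component of the iterate. Only the second kind contributes to the difference of two iterates. *)
Lemma field_arg_nth m n s v0 y0 i :
  length v0 = m -> length y0 = n -> (i < m + 1 + n)%nat ->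
  (exists i', (i' < S (m + n))%nat /\
     (forall U x, length x = S (m + n) -> nth i (field_arg m n U x) 0 = nth i' x 0) /\
     nth i (v0 ++ s :: y0) 0 = nth i' (s :: v0 ++ y0) 0) \/
  (exists j, (j < n)%nat /\
     (forall U x, length x = S (m + n) -> nth i (field_arg m n U x) 0 = U j x) /\
     nth i (v0 ++ s :: y0) 0 = nth j y0 0).
Proof.
  intros Hv Hy Hi. destruct (Nat.lt_ge_cases i m) as [Him|Him].
  - left. exists (S i). split; [lia|split].
    + intros U [|t x] Hx; [discriminate Hx|]. injection Hx as Hx. unfold field_arg. simpl.
      rewrite app_nth1 by (rewrite length_firstn; lia). rewrite nth_firstn.
      now apply Nat.ltb_lt in Him as ->.
    + simpl. now rewrite !app_nth1 by lia.
  - destruct (Nat.eq_dec i m) as [->|Hne].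
    + left. exists 0%nat. split; [lia|split].
      * intros U [|t x] Hx; [discriminate Hx|]. injection Hx as Hx. unfold field_arg. simpl.
        rewrite app_nth2, length_firstn by (rewrite length_firstn; lia).
        rewrite Nat.min_l, Nat.sub_diag by lia. reflexivity.
      * simpl. rewrite app_nth2, Hv, Nat.sub_diag by lia. reflexivity.
    + right. exists (i - m - 1)%nat. split; [lia|split].
      * intros U [|t x] Hx; [discriminate Hx|]. injection Hx as Hx. unfold field_arg. simpl.
        rewrite app_nth2, length_firstn by (rewrite length_firstn; lia).
        rewrite Nat.min_l by lia. replace (i - m)%nat with (S (i - m - 1)) by lia. simpl.
        rewrite Nat.sub_0_r. apply vec_nth. lia.
      * rewrite app_nth2, Hv by lia. replace (i - m)%nat with (S (i - m - 1)) by lia. simpl; f_equal; lia.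
Qed.

(** In [t :: v ++ y] the [j]-th initial value sits at position [S (m + j)], so the iteration starts
    from the function that is constantly [y] in time. *)
Fixpoint picard (m n : nat) (G : nat -> list R -> R) (sg : R) (N j : nat) (x : list R) : R :=
  match N with
  | O => nth (S (m + j)) x 0
  | S N => nth (S (m + j)) x 0 +
           RInt (fun u => G j (field_arg m n (picard m n G sg N) (u :: tl x))) sg (hd 0 x)
  end.

Lemma geometric_le C N M :
  0 <= C -> sum_f_R0 (fun i => C * (1/2) ^ (N + i)) M <= 2 * C * (1/2) ^ N.
Proof.
  intros HC. assert (E : sum_f_R0 (fun i => C * (1/2) ^ (N + i)) M =
    2 * C * (1/2) ^ N * (1 - (1/2) ^ S M)).
  { induction M as [|M IH].
    - simpl sum_f_R0. rewrite Nat.add_0_r. field.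
    - simpl sum_f_R0. rewrite IH, pow_add. cbn [pow]. field. }
  rewrite E. assert (0 < (1/2) ^ N) by (apply pow_lt; lra).
  assert (0 < (1/2) ^ S M) by (apply pow_lt; lra).
  rewrite <- (Rmult_1_r (2 * C * (1/2) ^ N)) at 2.
  apply Rmult_le_compat_l; [|lra]. apply Rmult_le_pos; lra.
Qed.

Lemma Un_cv_half_pow C : Un_cv (fun N => C * (1/2) ^ N) 0.
Proof.
  replace 0 with (C * 0) by ring. apply Un_cv_scal.
  apply is_lim_seq_Reals, is_lim_seq_geom. rewrite Rabs_pos_eq; lra.
Qed.

Lemma Un_cv_squeeze u l C : (forall N, Rabs (u N - l) <= C * (1/2) ^ N) -> Un_cv u l.
Proof.
  intros H e He. destruct (Un_cv_half_pow C e He) as [N0 HN]. exists N0. intros N HNN.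
  specialize (HN N HNN). specialize (H N). unfold Rdist in *. rewrite Rminus_0_r in HN.
  eapply Rle_lt_trans; [exact H|]. eapply Rle_lt_trans; [apply Rle_abs|exact HN].
Qed.

(** One integration of the field costs at most C = 2 rho B. The choice of [rho] means rho + 2 C =
    R0: the iterates stay within [R0] of [y0], with [rho] for the varying initial value and 2 C for
    the geometric sum of the increments, and C / R0 is at most 1/2, the contraction factor. The
    field is given at radius [2 * R0] because the Lipschitz estimate halves the radius. *)
Lemma local_flow m n v0 s y0 G R0 B rho sg :
  length v0 = m -> length y0 = n -> 0 < R0 -> 0 < B ->
  (forall j, (j < n)%nat -> ana (m + 1 + n) (v0 ++ s :: y0) (2 * R0) (G j) B) ->
  rho = R0 / (1 + 4 * B) -> Rabs (sg - s) < rho ->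
  exists U,
    (forall j, (j < n)%nat ->
       ana (S (m + n)) (s :: v0 ++ y0) rho (fun x => U j x - nth j y0 0) R0) /\
    (forall t v y, length v = m -> length y = n ->
       in_ball (S (m + n)) (s :: v0 ++ y0) rho (t :: v ++ y) ->
       forall j, (j < n)%nat ->
         is_RInt (fun u => G j (v ++ u :: vec n U (u :: v ++ y))) sg t
           (U j (t :: v ++ y) - nth j y 0)).
Proof.
  intros Hv Hy HR HB HG Hrho Hsg.
  set (k := S (m + n)). set (x0 := s :: v0 ++ y0). set (z0 := v0 ++ s :: y0) in *.
  set (u := picard m n G sg).
  assert (Hx0 : length x0 = k) by (unfold x0, k; simpl; rewrite length_app; lia).
  assert (HrhoR : rho * (1 + 4 * B) = R0) by (rewrite Hrho; field; lra).
  assert (Hrp : 0 < rho) by (rewrite Hrho; apply Rdiv_lt_0_compat; lra).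
  assert (HrB : 0 < rho * B) by (now apply Rmult_lt_0_compat).
  set (C := 2 * rho * B).
  assert (HC : 0 < C) by (unfold C; lra).
  assert (HCR : rho + 2 * C = R0) by (unfold C; lra).
  assert (Hcoord : forall j, (j < n)%nat ->
    ana k x0 rho (fun x => nth (S (m + j)) x 0 - nth j y0 0) rho).
  { intros j Hj. replace (nth j y0 0) with (nth (S (m + j)) x0 0).
    - apply ana_coord; [exact Hx0|exact Hrp|unfold k; lia].
    - unfold x0. simpl. rewrite app_nth2, Hv by lia. f_equal; lia. }
  (* The set on which the Picard operator is a contraction, with distances measured in the
     coefficient norm. *)
  set (near := fun (U : nat -> list R -> R) => forall j, (j < n)%nat ->
    ana k x0 rho (fun x => U j x - nth j y0 0) R0).
  assert (Harg : forall U i, near U -> (i < m + 1 + n)%nat ->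
    ana k x0 rho (fun x => nth i (field_arg m n U x) 0 - nth i z0 0) R0).
  { intros U i HU Hi.
    destruct (field_arg_nth m n s v0 y0 i Hv Hy Hi) as [(i' & Hi' & E1 & E2)|(j & Hj & E1 & E2)].
    - eapply ana_ext; [|eapply ana_le; [|apply (ana_coord k x0 rho i'); assumption]]; [|lra].
      intros x [Hx _]. unfold z0. rewrite E1, E2 by exact Hx. reflexivity.
    - eapply ana_ext; [|apply (HU j Hj)].
      intros x [Hx _]. unfold z0. rewrite E1, E2 by exact Hx. reflexivity. }
  assert (HGarg : forall U j, near U -> (j < n)%nat ->
    ana k x0 rho (fun x => G j (field_arg m n U x)) B).
  { intros U j HU Hj. apply (ana_comp k x0 rho (m + 1 + n) z0 (2 * R0) (G j) B R0);
      try assumption; [now apply HG|lra| |].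
    - intros x [Hx _]. now apply field_arg_length.
    - intros i Hi. now apply Harg. }
  assert (Hex : forall U j t y, near U -> (j < n)%nat -> in_ball k x0 rho (t :: y) ->
    ex_RInt (fun u => G j (field_arg m n U (u :: y))) sg t).
  { intros U j t y HU Hj Hb.
    now apply (proj1 (ana_int _ _ _ _ _ _ _ (HGarg U j HU Hj) Hsg)). }
  set (I := fun U j x => RInt (fun u => G j (field_arg m n U (u :: tl x))) sg (hd 0 x) : R).
  assert (HuS : forall N j x, u (S N) j x = nth (S (m + j)) x 0 + I (u N) j x) by reflexivity.
  assert (Hdiff : forall U V e, near U -> near V -> 0 <= e ->
    (forall j, (j < n)%nat -> ana k x0 rho (fun x => U j x - V j x) e) ->
    forall j, (j < n)%nat -> ana k x0 rho (fun x => I U j x - I V j x) (e / 2)).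
  { intros U V e HU HV He HUV j Hj.
    assert (HeR : 0 <= e / R0) by (apply Rdiv_le_0_compat; assumption).
    assert (HL : ana k x0 rho
      (fun x => G j (field_arg m n U x) - G j (field_arg m n V x)) (e / R0 * B)).
    { apply (ana_comp_lipschitz k x0 rho (m + 1 + n) z0 R0); try assumption.
      - now apply HG.
      - intros x [Hx _]. split; now apply field_arg_length.
      - intros i Hi. split; [now apply Harg|split; [now apply Harg|]].
        replace (R0 * (e / R0)) with e by (field; lra).
        destruct (field_arg_nth m n s v0 y0 i Hv Hy Hi) as [(i' & Hi' & E1 & _)|(j' & Hj' & E1 & _)].
        + eapply ana_ext; [|eapply ana_le; [|apply (ana_const k x0 rho 0); assumption]].
          * intros x [Hx _]. simpl. rewrite !E1 by exact Hx. ring.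
          * rewrite Rabs_R0. exact He.
        + eapply ana_ext; [|apply (HUV j' Hj')].
          intros x [Hx _]. simpl. rewrite !E1 by exact Hx. ring. }
    eapply ana_ext; [|eapply ana_le; [|apply (proj2 (ana_int _ _ _ _ _ _ _ HL Hsg))]].
    - intros [|t y] Hb; [destruct Hb as [Hb _]; discriminate Hb|]. unfold I. cbn [hd tl].
      apply (RInt_minus (V := R_CompleteNormedModule)); apply Hex; assumption.
    - replace (2 * rho * (e / R0 * B)) with (e * (C / R0)) by (unfold C; field; lra).
      apply Rmult_le_compat_l; [exact He|]. apply Rmult_le_reg_r with R0; [exact HR|].
      replace (C / R0 * R0) with C by (field; lra). lra. }
  (* The two bounds need each other: the contraction applies only to iterates that are [near], and
     an iterate stays [near] by summing the earlier increments. *)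
  assert (Hmain : forall N,
    (forall j, (j < n)%nat ->
       ana k x0 rho (fun x => u N j x - nth j y0 0) (rho + 2 * C * (1 - (1/2) ^ N))) /\
    (forall j, (j < n)%nat -> ana k x0 rho (fun x => u (S N) j x - u N j x) (C * (1/2) ^ N))).
  { assert (Hnear : forall N, (forall j, (j < n)%nat -> ana k x0 rho
      (fun x => u N j x - nth j y0 0) (rho + 2 * C * (1 - (1/2) ^ N))) -> near (u N)).
    { intros N H j Hj. eapply ana_le; [|apply (H j Hj)]. rewrite <- HCR.
      assert (0 < (1/2) ^ N) by (apply pow_lt; lra).
      assert (0 < C * (1/2) ^ N) by (now apply Rmult_lt_0_compat). lra. }
    induction N as [|N [IH1 IH2]].
    - assert (H0 : forall j, (j < n)%nat -> ana k x0 rho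
        (fun x => u 0%nat j x - nth j y0 0) (rho + 2 * C * (1 - (1/2) ^ 0))).
      { intros j Hj. eapply ana_le; [|apply (Hcoord j Hj)]. simpl; lra. }
      split; [exact H0|]. intros j Hj.
      eapply ana_ext; [|eapply ana_le; [|apply (proj2 (ana_int _ _ _ _ _ _ _
        (HGarg (u 0%nat) j (Hnear 0%nat H0) Hj) Hsg))]].
      + intros x _. rewrite HuS. symmetry. apply Rplus_minus_l.
      + simpl. unfold C; lra.
    - assert (H1 : forall j, (j < n)%nat -> ana k x0 rho
        (fun x => u (S N) j x - nth j y0 0) (rho + 2 * C * (1 - (1/2) ^ S N))).
      { intros j Hj. eapply ana_ext; [|eapply ana_le; [|apply ana_plus;
          [apply (IH1 j Hj)|apply (IH2 j Hj)]]].
        - intros x _; simpl; ring.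
        - simpl pow. lra. }
      split; [exact H1|]. intros j Hj.
      eapply ana_ext; [|eapply ana_le; [|refine (Hdiff (u (S N)) (u N) (C * (1/2) ^ N) _ _ _ _ j Hj)]];
        try assumption.
      + intros x _. rewrite !HuS. ring.
      + simpl pow. lra.
      + now apply Hnear.
      + now apply Hnear.
      + apply Rmult_le_pos; [lra|]. apply pow_le; lra. }
  assert (Hnear : forall N, near (u N)).
  { intros N j Hj. eapply ana_le; [|apply (proj1 (Hmain N) j Hj)]. rewrite <- HCR.
    assert (0 < (1/2) ^ N) by (apply pow_lt; lra).
    assert (0 < C * (1/2) ^ N) by (now apply Rmult_lt_0_compat). lra. }
  (* [Series] is total, so [U] has a value everywhere; it is shown to be the limit of the iterates
     on the polydisc. *)
  set (U := fun j x => u 0%nat j x + Series (fun i => u (S i) j x - u i j x)).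
  assert (Htel : forall j x N M,
    sum_f_R0 (fun i => u (S (N + i)) j x - u (N + i)%nat j x) M = u (S (N + M)) j x - u N j x).
  { intros j x N M. induction M as [|M IH].
    - simpl sum_f_R0. now rewrite Nat.add_0_r.
    - simpl sum_f_R0. rewrite IH. replace (N + S M)%nat with (S (N + M)) by lia. ring. }
  assert (HUcv : forall j x, (j < n)%nat -> in_ball k x0 rho x ->
    Un_cv (fun N => u N j x) (U j x)).
  { intros j x Hj Hx. apply CV_shift with 1%nat.
    assert (H : Un_cv (sum_f_R0 (fun i => u (S i) j x - u i j x))
      (Series (fun i => u (S i) j x - u i j x))).
    { apply (Series_abs_bounded _ (2 * C * (1/2) ^ 0)). intros N.
      eapply Rle_trans; [|apply (geometric_le C 0 N); lra]. apply sum_Rle. intros i _.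
      apply (ana_bound k x0 rho _ _ x (proj2 (Hmain i) j Hj) Hx). }
    unfold U. eapply Un_cv_ext; [|apply CV_plus; [apply (Un_cv_const (u 0%nat j x))|exact H]].
    intros N. cbv beta. change (u 0%nat j x + sum_f_R0 (fun i => u (S (0 + i)) j x - u (0 + i)%nat j x) N = u (N + 1)%nat j x). rewrite Htel. simpl (0 + N)%nat.
    replace (N + 1)%nat with (S N) by lia. ring. }
  assert (HUtail : forall N j, (j < n)%nat ->
    ana k x0 rho (fun x => U j x - u N j x) (2 * C * (1/2) ^ N)).
  { intros N j Hj. apply (ana_series k x0 rho
      (fun i x => u (S (N + i)) j x - u (N + i)%nat j x) (fun i => C * (1/2) ^ (N + i))).
    - intros i. apply (proj2 (Hmain (N + i)%nat) j Hj).
    - intros M. apply geometric_le; lra.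
    - intros x Hx. eapply Un_cv_ext; [intros M; symmetry; apply Htel|].
      apply CV_minus; [|apply Un_cv_const].
      intros e He. destruct (HUcv j x Hj Hx e He) as [N0 HN0]. exists N0.
      intros M HM. apply HN0. lia. }
  assert (HUnear : near U).
  { intros j Hj. eapply ana_ext; [|eapply ana_le; [|apply ana_plus;
      [apply (Hcoord j Hj)|apply (HUtail 0%nat j Hj)]]].
    - intros x _. unfold u at 1. simpl picard. ring.
    - simpl pow. lra. }
  exists U. split; [exact HUnear|].
  intros t v y Hlv Hly Hb j Hj.
  (* The fixed point equation: [u (S N) - y] tends to [I U] by the contraction applied to [U] and
     [u N], and to [U - y] by convergence of the iterates. *)
  assert (E : I U j (t :: v ++ y) = U j (t :: v ++ y) - nth j y 0).
  { apply (UL_sequence (fun N => u (S N) j (t :: v ++ y) - nth j y 0)).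
    - apply (Un_cv_squeeze _ _ C). intros N.
      replace (u (S N) j (t :: v ++ y) - nth j y 0) with (I (u N) j (t :: v ++ y)).
      + rewrite Rabs_minus_sym.
        replace (C * (1/2) ^ N) with (2 * C * (1/2) ^ N / 2) by field.
        refine (ana_bound k x0 rho _ _ (t :: v ++ y)
          (Hdiff U (u N) (2 * C * (1/2) ^ N) HUnear (Hnear N) _ (fun j => HUtail N j) j Hj) Hb).
        apply Rmult_le_pos; [lra|apply pow_le; lra].
      + rewrite HuS. simpl nth.
        replace (nth (m + j) (v ++ y) 0) with (nth j y 0); [ring|].
        rewrite app_nth2, Hlv by lia. f_equal; lia.
    - apply CV_minus; [|apply Un_cv_const].
      intros e He. destruct (HUcv j _ Hj Hb e He) as [N0 HN0]. exists N0.
      intros M HM. apply HN0. lia. }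
  rewrite <- E.
  apply (is_RInt_ext (V := R_NormedModule) (fun u => G j (field_arg m n U (u :: v ++ y)))).
  - intros w _. now rewrite field_arg_app.
  - apply (RInt_correct (V := R_CompleteNormedModule)). now apply Hex.
Qed.

(** * Solutions and their uniqueness *)

(** Betweenness from 0 treats positive and negative times alike; [seg t s] also says that [s] is
    reached before [t] when moving away from 0. *)
Definition seg (b t : R) : Prop := 0 <= t <= b \/ b <= t <= 0.

Lemma seg_0 b : seg b 0.
Proof. destruct (Rle_dec 0 b); [left|right]; lra. Qed.

Lemma seg_refl b : seg b b.
Proof. destruct (Rle_dec 0 b); [left|right]; lra. Qed.

Lemma seg_convex b s t u : seg b s -> seg b t -> s <= u <= t -> seg b u.
Proof.
  intros [Hs|Hs] [Ht|Ht] Hu; first [left; lra|right; lra].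
Qed.

Lemma seg_trans a b c : seg c b -> seg b a -> seg c a.
Proof. intros [H1|H1] [H2|H2]; first [left; lra|right; lra]. Qed.

Lemma dom_ok_seg D t s : dom_ok D -> D t -> seg t s -> D s.
Proof.
  intros [H|[H0 H]] Ht Hs; [now apply H in Ht|].
  destruct Hs; [apply (H 0 t)|apply (H t 0)]; assumption.
Qed.

(** Induction along an interval by a supremum argument. The step is required around every point and
    only moves away from 0, from a time where [P] holds. Negative [T] is handled by reflection. *)
Lemma seg_induction (P : R -> Prop) T :
  P 0 ->
  (forall s, seg T s -> exists eta, 0 < eta /\ forall s1 s2,
     Rabs (s1 - s) < eta -> Rabs (s2 - s) < eta -> seg s2 s1 -> seg T s2 -> P s1 -> P s2) ->
  P T.
Proof.
  assert (Hpos : forall (P : R -> Prop) T, 0 <= T -> P 0 ->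
    (forall s, seg T s -> exists eta, 0 < eta /\ forall s1 s2,
       Rabs (s1 - s) < eta -> Rabs (s2 - s) < eta -> seg s2 s1 -> seg T s2 -> P s1 -> P s2) ->
    P T).
  { clear. intros P T HT H0 H.
    destruct (completeness (fun x => 0 <= x <= T /\ P x)) as [m [Hub Hlub]].
    - exists T. intros x [Hx _]. apply Hx.
    - exists 0. split; [lra|exact H0].
    - assert (Hm : 0 <= m <= T).
      { split; [apply Hub; split; [lra|exact H0]|]. apply Hlub. intros x [Hx _]; apply Hx. }
      destruct (H m) as [eta [He Hstep]]; [left; lra|].
      assert (Hx : exists x, (0 <= x <= T /\ P x) /\ m - eta < x).
      { apply NNPP. intros Hn. assert (m <= m - eta); [|lra]. apply Hlub. intros x Hx.
        destruct (Rle_dec x (m - eta)); [assumption|]. exfalso; apply Hn.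
        exists x; split; [exact Hx|lra]. }
      destruct Hx as [x [[HxT HPx] Hxm]].
      assert (Hxle : x <= m) by (apply Hub; split; assumption).
      (* A step from just below the supremum [m] either reaches [T] or passes [m], which is
         absurd. *)
      assert (HP : P (Rmin (m + eta / 2) T)).
      { assert (Hmin : m <= Rmin (m + eta / 2) T <= m + eta / 2).
        { split; [apply Rmin_glb; lra|apply Rmin_l]. }
        assert (HminT := Rmin_r (m + eta / 2) T).
        apply (Hstep x); [apply Rabs_def1; lra|apply Rabs_def1; lra|left; lra|left; lra|exact HPx]. }
      destruct (Rle_dec T (m + eta / 2)) as [HTm|HTm].
      + now rewrite Rmin_right in HP by exact HTm.
      + rewrite Rmin_left in HP by lra.
        assert (m + eta / 2 <= m); [|lra]. apply Hub. split; [lra|exact HP]. }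
  intros H0 H. destruct (Rle_dec 0 T) as [HT|HT]; [now apply Hpos|].
  rewrite <- (Ropp_involutive T). apply (Hpos (fun x => P (- x)) (- T)); [lra|now rewrite Ropp_0|].
  intros s Hs. destruct (H (- s)) as [eta [He Hstep]].
  { destruct Hs; [right; lra|left; lra]. }
  exists eta; split; [exact He|]. intros s1 s2 H1 H2 H12 HT2. apply Hstep.
  - replace (- s1 - - s) with (- (s1 - s)) by ring. now rewrite Rabs_Ropp.
  - replace (- s2 - - s) with (- (s2 - s)) by ring. now rewrite Rabs_Ropp.
  - destruct H12; [right; lra|left; lra].
  - destruct HT2; [right; lra|left; lra].
Qed.

Definition comp_val (g : pfun (list R) (list R)) (j : nat) (x : list R) : R :=
  nth j (pval g x) 0.

(** Membership in [Hset] with the integrability proof replaced by the relation [is_RInt], which can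
    be split, added and compared directly. *)
Definition solution (n : nat) (f g : pfun (list R) (list R)) (v : list R)
    (h : pfun R (list R)) : Prop :=
  dom_ok (pdom h) /\ forall t, pdom h t ->
    pdom f v /\ pdom g (v ++ t :: pval h t) /\ length (pval h t) = n /\
    forall j, (j < n)%nat ->
      is_RInt (fun tau => comp_val g j (v ++ tau :: pval h tau)) 0 t
        (nth j (pval h t) 0 - nth j (pval f v) 0).

Lemma Hset_solution n f g v h : Hset n f g v h <-> solution n f g v h.
Proof.
  split.
  - intros (H1 & H2 & H3 & H4). split; [exact H1|]. intros t Ht.
    split; [now apply (H2 t)|split; [now apply H3|]].
    destruct (H4 t Ht) as [Hl Hj]. split; [exact Hl|]. intros j Hjn.
    destruct (Hj j Hjn) as [pr E]. rewrite E, <- RInt_Reals.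
    unfold Rminus. rewrite Rplus_comm, <- Rplus_assoc, Rplus_opp_l, Rplus_0_l.
    apply (RInt_correct (V := R_CompleteNormedModule)). now apply ex_RInt_Reals_1.
  - intros [H1 H]. split; [exact H1|split; [|split]].
    + intros t Ht. apply (H t Ht).
    + intros t Ht. apply (H t Ht).
    + intros t Ht. destruct (H t Ht) as (_ & _ & Hl & Hj). split; [exact Hl|].
      intros j Hjn. specialize (Hj j Hjn).
      assert (pr : Riemann_integrable
        (fun tau => nth j (pval g (v ++ tau :: pval h tau)) 0) 0 t).
      { apply ex_RInt_Reals_0. eexists; exact Hj. }
      exists pr. rewrite <- RInt_Reals.
      apply (is_RInt_unique (V := R_CompleteNormedModule)) in Hj.
      unfold comp_val in Hj. rewrite Hj. ring.
Qed.

Lemma solution_RInt n f g v h a b j :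
  solution n f g v h -> pdom h a -> pdom h b -> (j < n)%nat ->
  is_RInt (fun tau => comp_val g j (v ++ tau :: pval h tau)) a b
    (nth j (pval h b) 0 - nth j (pval h a) 0).
Proof.
  intros [_ H] Ha Hb Hj.
  destruct (H a Ha) as (_ & _ & _ & Ia). destruct (H b Hb) as (_ & _ & _ & Ib).
  specialize (Ia j Hj). specialize (Ib j Hj).
  apply (is_RInt_swap (V := R_NormedModule)) in Ia.
  assert (E := is_RInt_Chasles (V := R_NormedModule) _ _ _ _ _ _ Ia Ib).
  unfold plus, opp in E; simpl in E.
  replace (nth j (pval h b) 0 - nth j (pval h a) 0) with
    (- (nth j (pval h a) 0 - nth j (pval f v) 0) + (nth j (pval h b) 0 - nth j (pval f v) 0))
    by ring.
  exact E.
Qed.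

(** * Continuity and uniqueness of solutions *)

Lemma finite_positive_min n (P : nat -> R -> Prop) :
  (forall j, (j < n)%nat -> exists e, 0 < e /\ P j e) ->
  (forall j e e', 0 < e' <= e -> P j e -> P j e') ->
  exists e, 0 < e /\ forall j, (j < n)%nat -> P j e.
Proof.
  intros H Hm; induction n as [|n IH].
  - exists 1. split; [lra|]. intros; lia.
  - destruct IH as [e [He HP]]; [intros; apply H; lia|].
    destruct (H n ltac:(lia)) as [e' [He' HP']].
    exists (Rmin e e'). assert (Hmin : 0 < Rmin e e') by now apply Rmin_glb_lt.
    split; [exact Hmin|]. intros j Hj. destruct (Nat.eq_dec j n) as [->|Hne].
    + apply (Hm n e'); [|exact HP']. split; [exact Hmin|apply Rmin_r].
    + apply (Hm j e); [|apply HP; lia]. split; [exact Hmin|apply Rmin_l].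
Qed.

(** A Riemann integrable integrand is bounded, so a solution is Lipschitz between 0 and [T]; nothing
    about [g] itself is required. The bound [M] may be 0, hence the division by [M + 1]. *)
Lemma solution_continuous n f g v h T s e :
  solution n f g v h -> pdom h T -> seg T s -> 0 < e ->
  exists eta, 0 < eta /\ forall t, seg T t -> Rabs (t - s) < eta ->
    forall j, (j < n)%nat -> Rabs (nth j (pval h t) 0 - nth j (pval h s) 0) < e.
Proof.
  intros Hh HT Hs He.
  assert (Hdom : forall t, seg T t -> pdom h t) by (intros t; now apply dom_ok_seg; [apply Hh|]).
  destruct (finite_positive_min n (fun j eta => forall t, seg T t -> Rabs (t - s) < eta ->
    Rabs (nth j (pval h t) 0 - nth j (pval h s) 0) < e)) as [eta [H1 H2]].
  - intros j Hj.
    destruct (ex_RInt_ub (V := R_NormedModule)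
      (fun tau => comp_val g j (v ++ tau :: pval h tau)) 0 T) as [M HM].
    { eexists. apply (solution_RInt n f g v h 0 T j Hh); [apply Hdom, seg_0|exact HT|exact Hj]. }
    assert (HMs : forall t, seg T t -> Rabs (comp_val g j (v ++ t :: pval h t)) <= M).
    { intros t Ht. apply HM. unfold Rmin, Rmax.
      destruct (Rle_dec 0 T); destruct Ht; lra. }
    assert (HM0 : 0 <= M).
    { eapply Rle_trans; [apply Rabs_pos|apply (HMs s Hs)]. }
    exists (e / (M + 1)). split; [apply Rdiv_lt_0_compat; lra|].
    intros t Ht Hts.
    assert (I := solution_RInt n f g v h s t j Hh (Hdom s Hs) (Hdom t Ht) Hj).
    apply Rle_lt_trans with (Rabs (t - s) * M).
    + apply (norm_RInt_le_const_abs (V := R_NormedModule)) with (2 := I).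
      intros x Hx. apply HMs.
      destruct (Rle_dec s t); [rewrite Rmin_left, Rmax_right in Hx by lra|
        rewrite Rmin_right, Rmax_left in Hx by lra].
      * apply (seg_convex T s t); assumption.
      * apply (seg_convex T t s); assumption.
    + apply Rle_lt_trans with (e / (M + 1) * M).
      * apply Rmult_le_compat_r; lra.
      * apply Rmult_lt_reg_r with (M + 1); [lra|].
        replace (e / (M + 1) * M * (M + 1)) with (e * M) by (field; lra). lra.
  - intros j e1 e2 He12 H t Ht Hts. apply H; [exact Ht|lra].
  - exists eta. split; [exact H1|]. intros t Ht Hts j Hj. now apply H2.
Qed.

Lemma nth_point m n i :
  (i < m + 1 + n)%nat ->
  ((i < m)%nat /\ forall v t y, length v = m -> nth i (v ++ t :: y) 0 = nth i v 0) \/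
  (forall v t y, length v = m -> nth i (v ++ t :: y) 0 = t) \/
  (exists j, (j < n)%nat /\ forall v t y, length v = m -> nth i (v ++ t :: y) 0 = nth j y 0).
Proof.
  intros Hi. destruct (Nat.lt_ge_cases i m) as [Him|Him].
  - left. split; [exact Him|]. intros v t y Hv. apply app_nth1. lia.
  - right. destruct (Nat.eq_dec i m) as [->|Hne].
    + left. intros v t y Hv. rewrite app_nth2, Hv, Nat.sub_diag by lia. reflexivity.
    + right. exists (i - m - 1)%nat. split; [lia|]. intros v t y Hv.
      rewrite app_nth2, Hv by lia. replace (i - m)%nat with (S (i - m - 1)) by lia.
      simpl. f_equal. lia.
Qed.

(** The composition estimate applied to functions of zero variables, which are just points. *)
Lemma ana_point_lipschitz k z s G B e p q :
  ana k z (2 * s) G B -> 0 <= e -> length p = k -> length q = k ->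
  (forall i, (i < k)%nat ->
     Rabs (nth i p 0 - nth i z 0) <= s /\ Rabs (nth i q 0 - nth i z 0) <= s /\
     Rabs (nth i p 0 - nth i q 0) <= s * e) ->
  Rabs (G p - G q) <= e * B.
Proof.
  intros HG He Hp Hq H.
  assert (Hc : forall c b, Rabs c <= b -> ana 0 nil 1 (fun _ => c) b).
  { intros c b Hcb. apply (ana_le _ _ _ _ _ _ Hcb), ana_const; [reflexivity|lra]. }
  refine (ana_bound 0 nil 1 (fun _ => G p - G q) (e * B) nil _ _).
  - apply (ana_comp_lipschitz 0 nil 1 k z s G B e (fun _ => p) (fun _ => q)); auto; [lra|].
    intros i Hi. destruct (H i Hi) as (H1 & H2 & H3). auto.
  - apply in_ball_center; [reflexivity|lra].
Qed.

(** [analytic] speaks of the series only at points of the graph; an open domain makes the whole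
    polydisc such points. Taking [Rmax B 1] makes the bound positive. *)
Lemma analytic_ana k n F x :
  vecfun_wf k n F -> analytic k n (graph_of F) -> open_dom k (graph_of F) -> pdom F x ->
  exists r B, 0 < r /\ 0 < B /\ length x = k /\
    (forall y, in_ball k x r y -> pdom F y) /\
    (forall j, (j < n)%nat -> ana k x r (comp_val F j) B).
Proof.
  intros Hwf Ha Ho Hx. assert (Hlx : length x = k) by apply (Hwf x Hx).
  destruct (Ha x _ (conj Hx eq_refl)) as (r & Hr & c & [B HB] & HF).
  destruct (Ho x _ (conj Hx eq_refl)) as (e & He & Hdom).
  assert (Hm : 0 < Rmin r e) by now apply Rmin_glb_lt.
  assert (Hml := Rmin_l r e). assert (Hmr := Rmin_r r e).
  assert (Hd : forall y, in_ball k x (Rmin r e) y -> pdom F y).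
  { intros y [Hy Hb]. destruct (Hdom y) as [w [Hw _]]; [|exact Hw].
    split; [exact Hy|]. intros i Hi; specialize (Hb i Hi); lra. }
  exists (Rmin r e), (Rmax B 1). split; [exact Hm|split]; [|split; [exact Hlx|split; [exact Hd|]]].
  - eapply Rlt_le_trans; [apply Rlt_0_1|apply Rmax_r].
  - intros j Hj. repeat split; try assumption. exists (fun a => c a j). split.
    + intros N. eapply Rle_trans; [|apply Rmax_l]. eapply Rle_trans; [|apply (HB N j Hj)].
      apply box_sum_le. intros a _. apply Rmult_le_compat_l; [apply Rabs_pos|].
      apply monom_repeat_le; lra.
    + intros y Hy. apply (HF y (pval F y)); [|split; [now apply Hd|reflexivity]|exact Hj].
      destruct Hy as [Hy Hb]. split; [exact Hy|]. intros i Hi; specialize (Hb i Hi); lra.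
Qed.

(* In the induction step nothing is to be proved around a point where the two
   solutions differ, by continuity; around a point where they agree, the
   integral equation halves any bound on the distance between them. *)
Lemma solution_unique m n f g v h h' T :
  vecfun_wf (m + 1 + n) n g -> analytic (m + 1 + n) n (graph_of g) ->
  open_dom (m + 1 + n) (graph_of g) -> length v = m ->
  solution n f g v h -> solution n f g v h' -> pdom h T -> pdom h' T ->
  pval h T = pval h' T.
Proof.
  intros Hwf Ha Ho Hv Hh Hh' HT HT'.
  assert (Hdom : forall t, seg T t -> pdom h t) by (intros t; now apply dom_ok_seg; [apply Hh|]).
  assert (Hdom' : forall t, seg T t -> pdom h' t) by (intros t; now apply dom_ok_seg; [apply Hh'|]).
  assert (Hlen : forall t, seg T t -> length (pval h t) = n) by (intros t Ht; apply Hh, Hdom, Ht).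
  assert (Hlen' : forall t, seg T t -> length (pval h' t) = n)
    by (intros t Ht; apply Hh', Hdom', Ht).
  assert (E : forall j, (j < n)%nat -> nth j (pval h T) 0 = nth j (pval h' T) 0).
  { apply (seg_induction (fun t => forall j, (j < n)%nat ->
      nth j (pval h t) 0 = nth j (pval h' t) 0)).
    - intros j Hj.
      destruct Hh as [_ H]. destruct (H 0 (Hdom 0 (seg_0 T))) as (_ & _ & _ & I).
      destruct Hh' as [_ H']. destruct (H' 0 (Hdom' 0 (seg_0 T))) as (_ & _ & _ & I').
      specialize (I j Hj). specialize (I' j Hj).
      apply (is_RInt_unique (V := R_CompleteNormedModule)) in I, I'.
      rewrite RInt_point in I, I'. unfold zero in I, I'; simpl in I, I'. lra.
    - intros s Hs.
      destruct (classic (forall j, (j < n)%nat -> nth j (pval h s) 0 = nth j (pval h' s) 0))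
        as [Heq|Hne].
      + destruct (analytic_ana (m + 1 + n) n g (v ++ s :: pval h s) Hwf Ha Ho)
          as (r & B & Hr & HB & _ & _ & HG).
        { destruct Hh as [_ H]. apply (H s (Hdom s Hs)). }
        set (R0 := r / 2). assert (HR0 : 0 < R0) by (unfold R0; lra).
        replace r with (2 * R0) in HG by (unfold R0; field).
        destruct (solution_continuous n f g v h T s (R0 / 2) Hh HT Hs ltac:(lra))
          as [e1 [He1 Hc1]].
        destruct (solution_continuous n f g v h' T s (R0 / 2) Hh' HT' Hs ltac:(lra))
          as [e2 [He2 Hc2]].
        (* This makes [e3 * B] at most [R0 / 2]: the field has Lipschitz factor [B / R0], so
           integrating over a time below [e3] halves distances. *)
        set (e3 := R0 / (1 + 2 * B)).
        assert (He3 : 0 < e3) by (apply Rdiv_lt_0_compat; lra).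
        assert (He3R : e3 * (1 + 2 * B) = R0) by (unfold e3; field; lra).
        assert (He3B : 0 < e3 * B) by now apply Rmult_lt_0_compat.
        exists (Rmin (Rmin e1 e2) e3).
        split; [repeat apply Rmin_glb_lt; assumption|].
        assert (Hm1 := Rmin_l (Rmin e1 e2) e3). assert (Hm2 := Rmin_r (Rmin e1 e2) e3).
        assert (Hm3 := Rmin_l e1 e2). assert (Hm4 := Rmin_r e1 e2).
        set (eta := Rmin (Rmin e1 e2) e3) in *. clearbody eta.
        assert (Hhalf : forall N t, seg T t -> Rabs (t - s) < eta -> forall j, (j < n)%nat ->
          Rabs (nth j (pval h t) 0 - nth j (pval h' t) 0) <= R0 * (1/2) ^ N).
        { induction N as [|N IH]; intros t Ht Hts j Hj.
          - specialize (Hc1 t Ht ltac:(lra) j Hj). specialize (Hc2 t Ht ltac:(lra) j Hj).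
            rewrite <- (Heq j Hj) in Hc2. apply Rabs_def2 in Hc1, Hc2.
            simpl. apply Rabs_le_between. lra.
          - assert (Hhp : 0 < (1/2) ^ N) by (apply pow_lt; lra).
            assert (I := solution_RInt n f g v h s t j Hh (Hdom s Hs) (Hdom t Ht) Hj).
            assert (I' := solution_RInt n f g v h' s t j Hh' (Hdom' s Hs) (Hdom' t Ht) Hj).
            assert (J := is_RInt_minus (V := R_NormedModule) _ _ _ _ _ _ I I').
            apply (norm_RInt_le_const_abs (V := R_NormedModule)) with (M := (1/2) ^ N * B) in J.
            + unfold norm, minus, plus, opp in J; simpl in J. unfold abs in J; simpl in J.
              rewrite (Heq j Hj) in J.
              replace (nth j (pval h t) 0 - nth j (pval h' t) 0) with
                (nth j (pval h t) 0 - nth j (pval h' s) 0 +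
                 - (nth j (pval h' t) 0 - nth j (pval h' s) 0)) by ring.
              eapply Rle_trans; [exact J|].
              apply Rle_trans with (e3 * ((1/2) ^ N * B)).
              * apply Rmult_le_compat_r; [|lra]. apply Rmult_le_pos; lra.
              * replace (e3 * ((1/2) ^ N * B)) with ((1/2) ^ N * (e3 * B)) by ring.
                replace (R0 * (1/2) ^ S N) with ((1/2) ^ N * (R0 / 2)) by (simpl; field).
                apply Rmult_le_compat_l; lra.
            + intros x Hx.
              assert (Hxs : seg T x).
              { destruct (Rle_dec s t); [rewrite Rmin_left, Rmax_right in Hx by lra|
                  rewrite Rmin_right, Rmax_left in Hx by lra].
                - apply (seg_convex T s t); assumption.
                - apply (seg_convex T t s); assumption. }
              assert (Hxb : Rabs (x - s) < eta).
              { apply (Rabs_between s s t); [|exact Hts|exact Hx].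
                rewrite Rminus_diag, Rabs_R0. eapply Rle_lt_trans; [apply Rabs_pos|exact Hts]. }
              unfold norm, minus, plus, opp; simpl. unfold abs; simpl.
              apply (ana_point_lipschitz (m + 1 + n) (v ++ s :: pval h s) R0); [now apply HG|lra|..].
              * rewrite length_app; simpl. rewrite Hlen by exact Hxs. lia.
              * rewrite length_app; simpl. rewrite Hlen' by exact Hxs. lia.
              * intros i Hi.
                destruct (nth_point m n i Hi) as [[_ Hp]|[Hp|[j' [Hj' Hp]]]];
                  rewrite !Hp by exact Hv.
                -- rewrite Rminus_diag, Rabs_R0.
                   repeat split; try lra. apply Rmult_le_pos; lra.
                -- rewrite Rminus_diag, Rabs_R0. repeat split; try lra. apply Rmult_le_pos; lra.
                -- assert (D1 := Hc1 x Hxs ltac:(lra) j' Hj').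
                   assert (D2 := Hc2 x Hxs ltac:(lra) j' Hj'). rewrite <- (Heq j' Hj') in D2.
                   split; [lra|split; [lra|]]. now apply IH. }
        intros s1 s2 _ Hs2 _ HTs2 _ j Hj.
        apply Rminus_diag_uniq. apply (UL_sequence (fun _ => 0)).
        * apply (Un_cv_squeeze _ _ R0). intros N. rewrite Rminus_0_l, Rabs_Ropp. now apply Hhalf.
        * apply Un_cv_const.
      + apply not_all_ex_not in Hne as [j Hne]. apply imply_to_and in Hne as [Hj Hne].
        set (d := Rabs (nth j (pval h s) 0 - nth j (pval h' s) 0)).
        assert (Hd : 0 < d) by (apply Rabs_pos_lt; lra).
        destruct (solution_continuous n f g v h T s (d / 2) Hh HT Hs ltac:(lra))
          as [e1 [He1 Hc1]].
        destruct (solution_continuous n f g v h' T s (d / 2) Hh' HT' Hs ltac:(lra))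
          as [e2 [He2 Hc2]].
        exists (Rmin e1 e2). split; [now apply Rmin_glb_lt|].
        assert (Hm1 := Rmin_l e1 e2). assert (Hm2 := Rmin_r e1 e2).
        intros s1 s2 Hs1 _ H12 HTs2 HP. exfalso.
        assert (HTs1 := seg_trans _ _ _ HTs2 H12).
        specialize (Hc1 s1 HTs1 ltac:(lra) j Hj). specialize (Hc2 s1 HTs1 ltac:(lra) j Hj).
        specialize (HP j Hj). rewrite HP in Hc1.
        apply Rabs_def2 in Hc1, Hc2.
        assert (d < d); [|lra]. unfold d at 1. apply Rabs_def1; lra. }
  apply nth_ext with (d := 0) (d' := 0).
  - rewrite Hlen, Hlen' by apply seg_refl. reflexivity.
  - intros j Hj. rewrite Hlen in Hj by apply seg_refl. now apply E.
Qed.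

Lemma hv_graph_iff m n f g v t y :
  vecfun_wf (m + 1 + n) n g -> analytic (m + 1 + n) n (graph_of g) ->
  open_dom (m + 1 + n) (graph_of g) -> length v = m ->
  (hv_graph n f g v t y <-> exists h, solution n f g v h /\ pdom h t /\ pval h t = y).
Proof.
  intros Hwf Ha Ho Hv. split.
  - intros (h & [Hh _] & Ht & E). exists h. now rewrite <- Hset_solution.
  - intros (h & Hh & Ht & E). exists h. split; [split|split; assumption].
    + now apply Hset_solution.
    + intros h' Hh' u Hu Hu'. apply Hset_solution in Hh'.
      now apply (solution_unique m n f g v).
Qed.

(** For the converse, the values of [h] at different times may a priori come from different
    solutions. Uniqueness identifies them, between 0 and [t], with one solution reaching [t], whose
    integral equation [h] then inherits. *)
Lemma Hset_restrictions m n f g v h :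
  vecfun_wf (m + 1 + n) n g -> analytic (m + 1 + n) n (graph_of g) ->
  open_dom (m + 1 + n) (graph_of g) -> length v = m ->
  (Hset n f g v h <->
   exists J : R -> Prop, dom_ok J /\
     (forall t, pdom h t <-> (J t /\ exists y, hv_graph n f g v t y)) /\
     (forall t, pdom h t -> hv_graph n f g v t (pval h t))).
Proof.
  intros Hwf Ha Ho Hv. rewrite Hset_solution.
  assert (Hiff := fun t y => hv_graph_iff m n f g v t y Hwf Ha Ho Hv).
  split.
  - intros Hh. exists (pdom h).
    assert (H : forall t, pdom h t -> hv_graph n f g v t (pval h t)).
    { intros t Ht. apply Hiff. now exists h. }
    split; [apply Hh|split; [|exact H]]. intros t. split; [|tauto].
    intros Ht. split; [exact Ht|]. eexists. now apply H.
  - intros (J & HJ & Hdom & Hval).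
    assert (Hseg : forall t s, pdom h t -> seg t s -> pdom h s).
    { intros t s Ht Hs. apply Hdom. apply Hdom in Ht as [HJt [y Hy]].
      split; [now apply (dom_ok_seg J t)|]. apply Hiff in Hy as (h1 & Hh1 & Ht1 & _).
      exists (pval h1 s). apply Hiff. exists h1. split; [exact Hh1|split; [|reflexivity]].
      apply (dom_ok_seg _ t); [apply Hh1|exact Ht1|exact Hs]. }
    split.
    + destruct (classic (exists t, pdom h t)) as [[t0 Ht0]|Hn].
      * right. split; [apply (Hseg t0); [exact Ht0|apply seg_0]|].
        intros a b c Hda Hdb Hc. destruct (Rle_dec 0 c).
        -- apply (Hseg b); [exact Hdb|left; lra].
        -- apply (Hseg a); [exact Hda|right; lra].
      * left. intros t Ht. apply Hn. now exists t.
    + intros t Ht. assert (Hv' := Hval t Ht). apply Hiff in Hv' as (h1 & Hh1 & Ht1 & E1).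
      assert (Hagree : forall s, seg t s -> pval h s = pval h1 s).
      { intros s Hs. assert (Hs' := Hval s (Hseg t s Ht Hs)).
        apply Hiff in Hs' as (h2 & Hh2 & Hs2 & E2). rewrite <- E2.
        apply (solution_unique m n f g v); try assumption.
        apply (dom_ok_seg _ t); [apply Hh1|exact Ht1|exact Hs]. }
      destruct Hh1 as [_ H1]. destruct (H1 t Ht1) as (A1 & A2 & A3 & A4).
      rewrite E1 in *. split; [exact A1|split; [exact A2|split; [exact A3|]]].
      intros j Hj. apply (is_RInt_ext (V := R_NormedModule)) with (2 := A4 j Hj).
      intros x Hx. rewrite Hagree; [reflexivity|].
      unfold Rmin, Rmax in Hx. destruct (Rle_dec 0 t); [left; lra|right; lra].
Qed.

(** * Analytic dependence on parameters *)

Lemma solution_extend n f g v h a b w :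
  solution n f g v h -> pdom h a -> seg b a ->
  (forall t, Rmin a b <= t <= Rmax a b ->
     pdom g (v ++ t :: w t) /\ length (w t) = n /\
     forall j, (j < n)%nat ->
       is_RInt (fun u => comp_val g j (v ++ u :: w u)) a t
         (nth j (w t) 0 - nth j (pval h a) 0)) ->
  exists h', solution n f g v h' /\ pdom h' b /\ pval h' b = w b.
Proof.
  intros [Hdh Hh] Ha Hba Hw.
  (* Within [seg b] all times are on one side of 0, so absolute values tell which piece applies for
     either sign. At [a] itself the new piece [w] is used. *)
  set (val := fun t => if Rlt_dec (Rabs t) (Rabs a) then pval h t else w t).
  assert (Hin : forall t, seg b t -> Rabs t < Rabs a -> val t = pval h t /\ seg a t).
  { intros t Hbt Ht. unfold val. destruct (Rlt_dec (Rabs t) (Rabs a)); [|contradiction].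
    split; [reflexivity|]. revert Ht. unfold Rabs.
    destruct (Rcase_abs t), (Rcase_abs a); destruct Hba, Hbt; intros;
      first [left; lra|right; lra]. }
  assert (Hout : forall t, seg b t -> ~ Rabs t < Rabs a ->
    val t = w t /\ Rmin a b <= t <= Rmax a b).
  { intros t Hbt Ht. unfold val. destruct (Rlt_dec (Rabs t) (Rabs a)); [contradiction|].
    split; [reflexivity|]. revert Ht. unfold Rabs, Rmin, Rmax.
    destruct (Rcase_abs t), (Rcase_abs a), (Rle_dec a b); destruct Hba, Hbt; intros; lra. }
  assert (Hbb : val b = w b).
  { apply Hout; [apply seg_refl|]. apply Rle_not_lt. unfold Rabs.
    destruct (Rcase_abs b), (Rcase_abs a); destruct Hba; lra. }
  exists (PFun (seg b) val). cbn [pdom pval].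
  split; [split|split; [apply seg_refl|exact Hbb]]; cbn [pdom pval].
  - right. split; [apply seg_0|]. intros s t u Hs Ht Hu. now apply (seg_convex b s t).
  - intros t Ht. destruct (Hh a Ha) as (Hf & _ & _ & Ia).
    split; [exact Hf|].
    destruct (Rlt_dec (Rabs t) (Rabs a)) as [Hlt|Hge].
    + destruct (Hin t Ht Hlt) as [-> Hat].
      destruct (Hh t (dom_ok_seg _ a t Hdh Ha Hat)) as (_ & H2 & H3 & H4).
      split; [exact H2|split; [exact H3|]]. intros j Hj.
      apply (is_RInt_ext (V := R_NormedModule)) with (2 := H4 j Hj).
      intros x Hx. assert (Hx' : seg t x).
      { unfold Rmin, Rmax in Hx. destruct (Rle_dec 0 t); [left; lra|right; lra]. }
      destruct (Hin x) as [-> _]; [now apply (seg_trans x t b)|..|reflexivity].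
      eapply Rle_lt_trans; [|exact Hlt]. unfold Rabs.
      destruct (Rcase_abs x), (Rcase_abs t); destruct Hx'; lra.
    + destruct (Hout t Ht Hge) as [-> Hab].
      destruct (Hw t Hab) as (H2 & H3 & H4). split; [exact H2|split; [exact H3|]].
      intros j Hj.
      replace (nth j (w t) 0 - nth j (pval f v) 0) with
        (plus (nth j (pval h a) 0 - nth j (pval f v) 0) (nth j (w t) 0 - nth j (pval h a) 0) : R)
        by (unfold plus; simpl; ring).
      apply (is_RInt_Chasles (V := R_NormedModule)) with a.
      * apply (is_RInt_ext (V := R_NormedModule)) with (2 := Ia j Hj).
        intros x Hx. assert (Hx' : seg a x /\ Rabs x < Rabs a).
        { unfold Rmin, Rmax in Hx. unfold Rabs.
          destruct (Rle_dec 0 a); (split; [first [left; lra|right; lra]|]);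
          destruct (Rcase_abs x), (Rcase_abs a); lra. }
        destruct (Hin x) as [-> _]; [apply (seg_trans x a b); tauto|tauto|reflexivity].
      * apply (is_RInt_ext (V := R_NormedModule)) with (2 := H4 j Hj).
        intros x Hx. assert (Hx' : seg b x /\ ~ Rabs x < Rabs a).
        { revert Hge. unfold Rmin, Rmax in Hx. unfold Rabs.
          destruct (Rle_dec a t); destruct Hba, Ht;
          destruct (Rcase_abs x), (Rcase_abs a), (Rcase_abs t); intros;
          (split; [first [left; lra|right; lra]|lra]). }
        destruct (Hout x) as [-> _]; [tauto|tauto|reflexivity].
Qed.

Lemma list_bound (l : list R) : exists M, 0 <= M /\ forall j, Rabs (nth j l 0) <= M.
Proof.
  induction l as [|x l [M [HM IH]]].
  - exists 0. split; [lra|]. intros [|j]; simpl; rewrite Rabs_R0; lra.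
  - exists (Rmax M (Rabs x)). split; [eapply Rle_trans; [exact HM|apply Rmax_l]|].
    intros [|j]; simpl; [apply Rmax_r|]. eapply Rle_trans; [apply IH|apply Rmax_l].
Qed.

(** The quantifier order is the point: [rho] and the bound precede the starting time [sg], so they
    depend on the centre alone. The flow also stays in the domain of [g], as it remains within the
    radius where [g] is known to be defined. *)
Lemma analytic_flow m n g v0 s y0 :
  vecfun_wf (m + 1 + n) n g -> analytic (m + 1 + n) n (graph_of g) ->
  open_dom (m + 1 + n) (graph_of g) -> length v0 = m -> length y0 = n ->
  pdom g (v0 ++ s :: y0) ->
  exists rho B, 0 < rho /\ forall sg, Rabs (sg - s) < rho -> exists U,
    (forall j, (j < n)%nat -> ana (S (m + n)) (s :: v0 ++ y0) rho (U j) B) /\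
    (forall t v y, length v = m -> length y = n ->
       in_ball (S (m + n)) (s :: v0 ++ y0) rho (t :: v ++ y) ->
       pdom g (v ++ t :: vec n U (t :: v ++ y)) /\
       forall j, (j < n)%nat ->
         is_RInt (fun u => comp_val g j (v ++ u :: vec n U (u :: v ++ y))) sg t
           (U j (t :: v ++ y) - nth j y 0)).
Proof.
  intros Hwf Ha Ho Hv Hy Hg.
  destruct (analytic_ana _ _ g _ Hwf Ha Ho Hg) as (r & B & Hr & HB & Hz & Hdom & HG).
  set (R0 := r / 2). assert (HR0 : 0 < R0) by (unfold R0; lra).
  assert (Hrho : 0 < R0 / (1 + 4 * B)) by (apply Rdiv_lt_0_compat; lra).
  assert (HrhoR : R0 / (1 + 4 * B) <= R0).
  { apply Rmult_le_reg_r with (1 + 4 * B); [lra|].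
    replace (R0 / (1 + 4 * B) * (1 + 4 * B)) with R0 by (field; lra).
    assert (0 < R0 * B) by now apply Rmult_lt_0_compat. lra. }
  destruct (list_bound y0) as [M [HM HyM]].
  exists (R0 / (1 + 4 * B)), (R0 + M). split; [exact Hrho|]. intros sg Hsg.
  destruct (local_flow m n v0 s y0 (comp_val g) R0 B (R0 / (1 + 4 * B)) sg Hv Hy HR0 HB)
    as [U [HU HI]]; [|reflexivity|exact Hsg|].
  { replace (2 * R0) with r by (unfold R0; field). exact HG. }
  exists U. split.
  - intros j Hj. eapply ana_ext; [|eapply ana_le; [|apply ana_plus; [apply (HU j Hj)|
      apply (ana_const _ _ _ (nth j y0 0)); [simpl; rewrite length_app; lia|exact Hrho]]]].
    + intros x _; simpl; ring.
    + specialize (HyM j). lra.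
  - intros t v y Hlv Hly Hb. split; [|now apply HI].
    apply Hdom. split; [rewrite length_app; simpl; rewrite vec_length; lia|].
    intros i Hi. destruct (field_arg_nth m n s v0 y0 i Hv Hy Hi)
      as [(i' & Hi' & E1 & E2)|(j & Hj & E1 & E2)];
      rewrite <- (field_arg_app m n U t v y Hlv), E1, E2 by apply Hb.
    + eapply Rlt_le_trans; [apply Hb, Hi'|]. unfold R0 in HrhoR at 2. lra.
    + eapply Rle_lt_trans; [apply (ana_bound _ _ _ _ _ _ (HU j Hj) Hb)|]. unfold R0; lra.
Qed.

Lemma in_ball_flow_arg m n s v0 y0 rho t v y :
  length v0 = m -> length y0 = n -> length v = m -> length y = n ->
  Rabs (t - s) < rho -> (forall i, (i < m)%nat -> Rabs (nth i v 0 - nth i v0 0) < rho) ->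
  (forall j, (j < n)%nat -> Rabs (nth j y 0 - nth j y0 0) < rho) ->
  in_ball (S (m + n)) (s :: v0 ++ y0) rho (t :: v ++ y).
Proof.
  intros Hv0 Hy0 Hv Hy Ht Hvv Hyy. split; [simpl; rewrite length_app; lia|].
  intros [|i] Hi; simpl; [exact Ht|]. destruct (Nat.lt_ge_cases i m).
  - rewrite !app_nth1 by lia. now apply Hvv.
  - rewrite !app_nth2 by lia. rewrite Hv, Hv0. apply Hyy. lia.
Qed.

Lemma ana_flow_comp m n s v0 y0 rho B F k x r T V Y :
  ana (S (m + n)) (s :: v0 ++ y0) rho F B -> length v0 = m -> length y0 = n ->
  length x = k -> 0 < r ->
  (forall w, in_ball k x r w -> length (V w) = m) ->
  ana k x r (fun w => T w - s) (rho / 2) ->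
  (forall i, (i < m)%nat -> ana k x r (fun w => nth i (V w) 0 - nth i v0 0) (rho / 2)) ->
  (forall j, (j < n)%nat -> ana k x r (fun w => Y j w - nth j y0 0) (rho / 2)) ->
  ana k x r (fun w => F (T w :: V w ++ vec n Y w)) B.
Proof.
  intros HF Hv Hy Hx Hr HV HT HVa HYa.
  assert (Hrho : 0 < rho) by apply HF.
  apply (ana_comp k x r (S (m + n)) (s :: v0 ++ y0) rho F B (rho / 2)
    (fun w => T w :: V w ++ vec n Y w)); try assumption; [lra|..].
  - intros w Hw. simpl. rewrite length_app, vec_length, HV by exact Hw. reflexivity.
  - intros [|i] Hi; simpl; [exact HT|]. destruct (Nat.lt_ge_cases i m) as [Him|Him].
    + eapply ana_ext; [|apply (HVa i Him)]. intros w Hw. simpl.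
      rewrite !app_nth1 by (rewrite ?HV by exact Hw; lia). reflexivity.
    + eapply ana_ext; [|apply (HYa (i - m)%nat); lia]. intros w Hw. simpl.
      rewrite !app_nth2 by (rewrite ?HV by exact Hw; lia).
      rewrite HV, Hv, vec_nth by (exact Hw || lia). reflexivity.
Qed.

(** The property carried along the time axis. Besides analyticity of the value it records that
    solutions for all nearby parameters survive up to [s], so that they can be extended from
    there. *)
Definition analytic_at_time (m n : nat) (f g : pfun (list R) (list R)) (v0 : list R) (s : R) :=
  exists d B W, 0 < d /\
    (forall j, (j < n)%nat -> ana m v0 d (W j) B) /\
    (forall v, in_ball m v0 d v ->
       exists h, solution n f g v h /\ pdom h s /\ pval h s = vec n W v).

Lemma small_factor d rho B : 0 < d -> 0 < rho -> exists t,
  0 < t <= 1 /\ t * d <= rho /\ t * B <= rho.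
Proof.
  intros Hd Hrho. assert (HB := Rabs_pos B).
  exists (Rmin 1 (rho / (d + Rabs B))).
  assert (H1 : 0 < rho / (d + Rabs B)) by (apply Rdiv_lt_0_compat; lra).
  assert (H2 : Rmin 1 (rho / (d + Rabs B)) * (d + Rabs B) <= rho).
  { apply Rle_trans with (rho / (d + Rabs B) * (d + Rabs B)).
    - apply Rmult_le_compat_r; [lra|apply Rmin_r].
    - right; field; lra. }
  assert (H3 : 0 < Rmin 1 (rho / (d + Rabs B))) by (apply Rmin_glb_lt; lra).
  set (t := Rmin _ _) in *.
  assert (0 < t * d) by now apply Rmult_lt_0_compat.
  assert (0 <= t * Rabs B) by (apply Rmult_le_pos; lra).
  assert (t * B <= t * Rabs B) by (apply Rmult_le_compat_l; [lra|apply Rle_abs]).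
  split; [split; [exact H3|apply Rmin_l]|split; lra].
Qed.

(** At time 0 a solution on the one-point interval suffices. It exists for nearby [v] because [f v]
    stays close to [f v0] and the domain of [g] is open. *)
Lemma analytic_at_time_0 m n f g v0 :
  vecfun_wf m n f -> analytic m n (graph_of f) -> open_dom m (graph_of f) ->
  open_dom (m + 1 + n) (graph_of g) -> length v0 = m -> pdom f v0 ->
  pdom g (v0 ++ 0 :: pval f v0) ->
  analytic_at_time m n f g v0 0.
Proof.
  intros Hwf Ha Ho Hog Hv Hf Hg.
  destruct (analytic_ana m n f v0 Hwf Ha Ho Hf) as (r & B & Hr & HB & _ & Hdom & HF).
  destruct (Hog _ _ (conj Hg eq_refl)) as (e & He & Hge).
  destruct (small_factor r (e / 2) B Hr ltac:(lra)) as (t & Ht & Htr & HtB).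
  assert (Htr' : 0 < t * r <= r).
  { split; [apply Rmult_lt_0_compat; lra|].
    assert (t * r <= 1 * r) by (apply Rmult_le_compat_r; lra). lra. }
  exists (t * r), B, (comp_val f). split; [lra|split].
  - intros j Hj. apply (ana_restrict m v0 r); [exact Htr'|now apply HF].
  - intros v Hb.
    assert (Hfv : pdom f v).
    { apply Hdom. destruct Hb as [Hl Hb]. split; [exact Hl|].
      intros i Hi; specialize (Hb i Hi); lra. }
    assert (Hlv : length v = m) by apply Hb.
    assert (Hfl : length (pval f v) = n) by (apply (Hwf v Hfv)).
    assert (Hfl0 : length (pval f v0) = n) by (apply (Hwf v0 Hf)).
    exists (PFun (fun u => u = 0) (fun _ => pval f v)). cbn [pdom pval].
    split; [split|split; [reflexivity|]]; cbn [pdom pval].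
    + right. split; [reflexivity|]. intros; lra.
    + intros u ->. split; [exact Hfv|split; [|split; [exact Hfl|]]].
      * destruct (Hge (v ++ 0 :: pval f v)) as [w [Hw _]]; [|exact Hw].
        split; [rewrite length_app; simpl; lia|]. intros i Hi.
        destruct (nth_point m n i Hi) as [[Him Hp]|[Hp|[j [Hj Hp]]]];
          rewrite !Hp by assumption.
        -- apply Rlt_le_trans with (t * r); [apply Hb, Him|lra].
        -- rewrite Rminus_diag, Rabs_R0. exact He.
        -- eapply Rle_lt_trans; [apply (ana_bound _ _ _ _ _ v
             (ana_shrink m v0 r t (comp_val f j) B Ht (HF j Hj)) Hb)|lra].
      * intros j Hj. rewrite Rminus_diag.
        apply (is_RInt_point (V := R_NormedModule)).
    + apply nth_ext with (d := 0) (d' := 0); [now rewrite vec_length|].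
      intros j Hj. rewrite vec_nth by lia. reflexivity.
Qed.

Section Dependence.

Context (m n : nat) (f g : pfun (list R) (list R)).
Context (Hf : vecfun_wf m n f) (Hg : vecfun_wf (m + 1 + n) n g).
Context (Haf : analytic m n (graph_of f)) (Hof : open_dom m (graph_of f)).
Context (Hag : analytic (m + 1 + n) n (graph_of g)) (Hog : open_dom (m + 1 + n) (graph_of g)).

(** The flow [U] and the value [W] at the starting time are kept apart, with [t] free. One statement
    then serves both for the step to a fixed later time, analytic in [v], and for joint analyticity
    in (v, t). *)
Lemma local_dependence v0 h0 T s :
  length v0 = m -> solution n f g v0 h0 -> pdom h0 T -> seg T s ->
  exists rho B eta, 0 < rho /\ 0 < eta <= rho / 2 /\
    forall s1, seg T s1 -> Rabs (s1 - s) < eta -> analytic_at_time m n f g v0 s1 ->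
    exists d U W, 0 < d <= rho / 2 /\
      (forall j, (j < n)%nat -> ana m v0 d (fun v => W j v - nth j (pval h0 s) 0) (rho / 2)) /\
      (forall j, (j < n)%nat -> ana (S (m + n)) (s :: v0 ++ pval h0 s) rho (U j) B) /\
      forall v t, in_ball m v0 d v -> Rabs (t - s) < rho -> seg t s1 ->
        exists h, solution n f g v h /\ pdom h t /\ pval h t = vec n U (t :: v ++ vec n W v).
Proof.
  intros Hv Hh0 HT Hs.
  assert (Hdom : forall t, seg T t -> pdom h0 t) by (intros t; now apply dom_ok_seg; [apply Hh0|]).
  assert (Hsol := proj2 Hh0 s (Hdom s Hs)). destruct Hsol as (_ & Hgs & Hy & _).
  destruct (analytic_flow m n g v0 s (pval h0 s) Hg Hag Hog Hv Hy Hgs) as (rho & B & Hrho & Hflow).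
  destruct (solution_continuous n f g v0 h0 T s (rho / 4) Hh0 HT Hs ltac:(lra))
    as (eta & Heta & Hcont).
  exists rho, B, (Rmin eta (rho / 2)). split; [exact Hrho|split].
  { split; [apply Rmin_glb_lt; lra|apply Rmin_r]. }
  intros s1 Hs1 Hs1s (d & BW & W & Hd & HW & Hsolv).
  assert (Hm1 := Rmin_l eta (rho / 2)). assert (Hm2 := Rmin_r eta (rho / 2)).
  destruct (Hflow s1 ltac:(lra)) as (U & HU & HI).
  destruct (small_factor d (rho / 4) BW Hd ltac:(lra)) as (th & Hth & Hthd & HthB).
  assert (Hthd' : 0 < th * d <= d).
  { split; [apply Rmult_lt_0_compat; lra|].
    assert (th * d <= 1 * d) by (apply Rmult_le_compat_r; lra). lra. }
  (* Uniqueness ties [W] to the given solution. Continuity puts its value at [s1] within rho/4 of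
     that at [s], and shrinking the polydisc by [th] costs the other rho/4, so [W] stays in the
     domain of the flow. *)
  assert (HWv0 : vec n W v0 = pval h0 s1).
  { destruct (Hsolv v0 (in_ball_center _ _ _ Hv Hd)) as (h & Hh & Hhs & <-).
    apply (solution_unique m n f g v0); try assumption. now apply Hdom. }
  assert (HW' : forall j, (j < n)%nat ->
    ana m v0 (th * d) (fun v => W j v - nth j (pval h0 s) 0) (rho / 2)).
  { intros j Hj. eapply ana_ext; [|eapply ana_le; [|apply ana_plus;
      [apply (ana_shrink m v0 d th _ _ Hth (HW j Hj))|
       apply (ana_const _ _ _ (W j v0 - nth j (pval h0 s) 0)); [exact Hv|lra]]]].
    - intros y _; simpl; ring.
    - rewrite <- (vec_nth n W v0 j Hj), HWv0.
      specialize (Hcont s1 Hs1 ltac:(lra) j Hj). lra. }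
  exists (th * d), U, W. split; [lra|split; [exact HW'|split; [exact HU|]]].
  intros v t Hb Hts Hseg.
  assert (Hlv : length v = m) by apply Hb.
  destruct (Hsolv v) as (h & Hh & Hhs & Eh).
  { split; [exact Hlv|]. intros i Hi. eapply Rlt_le_trans; [apply Hb, Hi|lra]. }
  apply (solution_extend n f g v h s1 t (fun u => vec n U (u :: v ++ vec n W v)) Hh Hhs Hseg).
  intros u Hu.
  destruct (HI u v (vec n W v) Hlv (vec_length _ _ _)) as [H1 H2].
  - apply in_ball_flow_arg; try assumption; [apply vec_length|..].
    + apply (Rabs_between s s1 t); [lra|exact Hts|exact Hu].
    + intros i Hi. eapply Rlt_le_trans; [apply Hb, Hi|lra].
    + intros j Hj. rewrite vec_nth by exact Hj.
      eapply Rle_lt_trans; [apply (ana_bound _ _ _ _ _ v (HW' j Hj) Hb)|lra].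
  - split; [exact H1|split; [apply vec_length|]]. intros j Hj.
    rewrite Eh, (vec_nth n U) by exact Hj. now apply H2.
Qed.

Lemma analytic_at_every_time v0 h0 T :
  length v0 = m -> solution n f g v0 h0 -> pdom h0 T -> analytic_at_time m n f g v0 T.
Proof.
  intros Hv Hh0 HT. apply seg_induction.
  - assert (H0 : pdom h0 0) by (apply (dom_ok_seg _ T); [apply Hh0|exact HT|apply seg_0]).
    destruct (proj2 Hh0 0 H0) as (H1 & H2 & H3 & H4).
    apply analytic_at_time_0; try assumption.
    replace (pval f v0) with (pval h0 0); [exact H2|].
    apply nth_ext with (d := 0) (d' := 0).
    + rewrite H3. symmetry. apply (Hf v0 H1).
    + intros j Hj. rewrite H3 in Hj. specialize (H4 j Hj).
      apply (is_RInt_unique (V := R_CompleteNormedModule)) in H4.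
      rewrite RInt_point in H4. unfold zero in H4; simpl in H4. lra.
  - intros s Hs.
    destruct (local_dependence v0 h0 T s Hv Hh0 HT Hs) as (rho & B & eta & Hrho & Heta & Hloc).
    exists eta. split; [apply Heta|]. intros s1 s2 Hs1 Hs2 H12 HTs2 Hat.
    destruct (Hloc s1 (seg_trans _ _ _ HTs2 H12) Hs1 Hat) as (d & U & W & Hd & HW & HU & Hsol).
    assert (Hys : length (pval h0 s) = n).
    { apply (proj2 Hh0 s). apply (dom_ok_seg _ T); [apply Hh0|exact HT|exact Hs]. }
    exists d, B, (fun j v => U j (s2 :: v ++ vec n W v)). split; [lra|split].
    + intros j Hj.
      apply (ana_flow_comp m n s v0 (pval h0 s) rho B (U j) m v0 d (fun _ => s2) (fun v => v) W);
        try assumption; [now apply HU|lra|..].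
      * intros w Hw; apply Hw.
      * eapply ana_le; [|apply ana_const; [exact Hv|lra]]. lra.
      * intros i Hi. eapply ana_le; [|apply ana_coord; [exact Hv|lra|exact Hi]]. lra.
    + intros v Hb. destruct (Hsol v s2 Hb ltac:(lra) H12) as (h & Hh & Hhs & E).
      exists h. split; [exact Hh|split; [exact Hhs|]]. rewrite E.
      apply nth_ext with (d := 0) (d' := 0); [now rewrite !vec_length|].
      intros j Hj. rewrite vec_length in Hj. now rewrite !vec_nth.
Qed.

(* A starting time slightly before [t]: every time close to [t] then lies
   beyond it, so that only forward extension of solutions is needed. *)
Lemma earlier_time t eta :
  0 < eta -> exists s e, 0 < e /\ seg t s /\ Rabs (s - t) < eta /\
    forall u, Rabs (u - t) < e -> seg u s.
Proof.
  intros Heta. destruct (Rtotal_order t 0) as [Ht|[Ht|Ht]].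
  - exists (Rmin 0 (t + eta / 2)), (Rmin (- t) (eta / 2)).
    assert (H1 := Rmin_l (- t) (eta / 2)). assert (H2 := Rmin_r (- t) (eta / 2)).
    assert (H3 := Rmin_l 0 (t + eta / 2)). assert (H4 := Rmin_r 0 (t + eta / 2)).
    assert (H5 : t + Rmin (- t) (eta / 2) <= Rmin 0 (t + eta / 2)) by (apply Rmin_glb; lra).
    assert (H6 : 0 < Rmin (- t) (eta / 2)) by (apply Rmin_glb_lt; lra).
    split; [exact H6|split; [right; lra|split; [apply Rabs_def1; lra|]]].
    intros u Hu. apply Rabs_def2 in Hu. right; lra.
  - exists 0, 1. split; [lra|split; [apply seg_0|split]].
    + rewrite Ht, Rminus_diag, Rabs_R0. exact Heta.
    + intros u _. apply seg_0.
  - exists (Rmax 0 (t - eta / 2)), (Rmin t (eta / 2)).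
    assert (H1 := Rmin_l t (eta / 2)). assert (H2 := Rmin_r t (eta / 2)).
    assert (H3 := Rmax_l 0 (t - eta / 2)). assert (H4 := Rmax_r 0 (t - eta / 2)).
    assert (H5 : Rmax 0 (t - eta / 2) <= t - Rmin t (eta / 2)) by (apply Rmax_lub; lra).
    assert (H6 : 0 < Rmin t (eta / 2)) by (apply Rmin_glb_lt; lra).
    split; [exact H6|split; [left; lra|split; [apply Rabs_def1; lra|]]].
    intros u Hu. apply Rabs_def2 in Hu. left; lra.
Qed.

(** * Joint analyticity of PR in parameter and time *)

Lemma PR_graph_iff v t y :
  length v = m ->
  (PR_graph m n f g (v ++ t :: nil) y <->
   exists h, solution n f g v h /\ pdom h t /\ pval h t = y).
Proof.
  intros Hv. rewrite <- (hv_graph_iff m n f g v t y Hg Hag Hog Hv). split.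
  - intros (v' & t' & _ & E & H). apply app_inj_tail in E as [-> ->]. exact H.
  - intros H. now exists v, t.
Qed.

Lemma split_last (x : list R) :
  length x = (m + 1)%nat -> x = firstn m x ++ nth m x 0 :: nil /\ length (firstn m x) = m.
Proof.
  intros Hx. split; [|rewrite length_firstn; lia].
  rewrite <- (firstn_skipn m x) at 1. f_equal.
  assert (Hl : length (skipn m x) = 1%nat) by (rewrite length_skipn; lia).
  assert (E : nth 0 (skipn m x) 0 = nth m x 0) by (rewrite nth_skipn; f_equal; lia).
  destruct (skipn m x) as [|a [|b l]]; try discriminate Hl. simpl in E. now rewrite E.
Qed.

(** The flow is centred at time [T] but started at the earlier [s1], where the dependence on [v] is
    already known. It covers times on both sides of [T], even when the domain of [h0] ends at
    [T]. *)
Lemma PR_local x z :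
  PR_graph m n f g x z ->
  exists r B F, 0 < r /\ (forall j, (j < n)%nat -> ana (m + 1) x r (F j) B) /\
    forall y, in_ball (m + 1) x r y -> PR_graph m n f g y (vec n F y).
Proof.
  intros H. assert (H' := H). destruct H' as (v0 & T & Hv & -> & _).
  apply PR_graph_iff in H as (h0 & Hh0 & HT & Ez); [|exact Hv].
  destruct (local_dependence v0 h0 T T Hv Hh0 HT (seg_refl T))
    as (rho & B & eta & Hrho & Heta & Hloc).
  destruct (earlier_time T eta) as (s1 & e & He & Hs1 & Hs1T & Hbeyond); [lra|].
  assert (Hat : analytic_at_time m n f g v0 s1).
  { apply (analytic_at_every_time v0 h0); try assumption.
    apply (dom_ok_seg _ T); [apply Hh0|exact HT|exact Hs1]. }
  destruct (Hloc s1 Hs1 Hs1T Hat) as (d & U & W & Hd & HW & HU & Hsol).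
  assert (Hys : length (pval h0 T) = n) by apply (proj2 Hh0 T HT).
  (* Half of [d] gives the strict [r < d] needed to compose with [W]; [e] keeps every time within
     [r] of [T] beyond [s1]. *)
  set (r := Rmin (d / 2) e).
  assert (Hr : 0 < r) by (apply Rmin_glb_lt; lra).
  assert (Hrd : r <= d / 2) by apply Rmin_l. assert (Hre : r <= e) by apply Rmin_r.
  clearbody r.
  assert (Hx : length (v0 ++ T :: nil) = (m + 1)%nat) by (rewrite length_app; simpl; lia).
  assert (Hxi : forall i, (i < m)%nat -> nth i (v0 ++ T :: nil) 0 = nth i v0 0).
  { intros i Hi. apply app_nth1. lia. }
  assert (HxT : nth m (v0 ++ T :: nil) 0 = T).
  { rewrite app_nth2, Hv, Nat.sub_diag by lia. reflexivity. }
  assert (Hfst : forall i y, (i < m)%nat -> nth i (firstn m y) 0 = nth i y 0).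
  { intros i y Hi. rewrite nth_firstn. now apply Nat.ltb_lt in Hi as ->. }
  assert (Hcoord : forall i, (i < m)%nat ->
    ana (m + 1) (v0 ++ T :: nil) r (fun y => nth i (firstn m y) 0 - nth i v0 0) r).
  { intros i Hi. eapply ana_ext; [|apply (ana_coord _ _ r i Hx Hr); lia].
    intros y _; simpl. now rewrite Hxi, Hfst. }
  exists r, B, (fun j y => U j (nth m y 0 :: firstn m y ++ vec n (fun j y => W j (firstn m y)) y)).
  split; [exact Hr|split].
  - intros j Hj.
    apply (ana_flow_comp m n T v0 (pval h0 T) rho B (U j) (m + 1) (v0 ++ T :: nil) r
      (fun y => nth m y 0) (firstn m)); try assumption; [now apply HU|..].
    + intros w [Hw _]. rewrite length_firstn. lia.
    + eapply ana_ext; [|eapply ana_le; [|apply (ana_coord _ _ r m Hx Hr); lia]]; [|lra].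
      intros y _; simpl. now rewrite HxT.
    + intros i Hi. apply (ana_le _ _ _ _ r); [lra|now apply Hcoord].
    + intros i Hi. apply (ana_comp (m + 1) (v0 ++ T :: nil) r m v0 d
        (fun v => W i v - nth i (pval h0 T) 0) (rho / 2) r (firstn m)); try assumption;
        [now apply HW|lra|].
      intros w [Hw _]. rewrite length_firstn. lia.
  - intros y [Hy Hb]. destruct (split_last y Hy) as [Ey Hl].
    rewrite Ey at 1. apply PR_graph_iff; [exact Hl|].
    destruct (Hsol (firstn m y) (nth m y 0)) as (h & Hh & Hht & E).
    + split; [exact Hl|]. intros i Hi. rewrite Hfst by exact Hi.
      specialize (Hb i ltac:(lia)). rewrite Hxi in Hb by exact Hi. lra.
    + specialize (Hb m ltac:(lia)). rewrite HxT in Hb. lra.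
    + apply Hbeyond. specialize (Hb m ltac:(lia)). rewrite HxT in Hb. lra.
    + exists h. split; [exact Hh|split; [exact Hht|exact E]].
Qed.

(** [analytic] quantifies over all values in the graph, so these must be identified with the one
    given by the series. *)
Lemma PR_functional x z w : PR_graph m n f g x z -> PR_graph m n f g x w -> z = w.
Proof.
  intros H. assert (H' := H). destruct H' as (v & t & Hv & -> & _). intros H'.
  apply PR_graph_iff in H as (h & Hh & Ht & <-); [|exact Hv].
  apply PR_graph_iff in H' as (h' & Hh' & Ht' & <-); [|exact Hv].
  now apply (solution_unique m n f g v).
Qed.

Lemma PR_open : open_dom (m + 1) (PR_graph m n f g).
Proof.
  intros x z H. destruct (PR_local x z H) as (r & B & F & Hr & _ & HF).
  exists r. split; [exact Hr|]. intros y Hy. eexists. now apply HF.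
Qed.

Lemma PR_analytic : analytic (m + 1) n (PR_graph m n f g).
Proof.
  intros x z H. destruct (PR_local x z H) as (r & B & F & Hr & HA & HF).
  exists r. split; [exact Hr|].
  (* One coefficient family for all components is required; indices beyond [n] receive zeros. *)
  destruct (functional_choice (fun j (c : list nat -> R) => (j < n)%nat ->
    (forall N, box_sum (m + 1) N (fun a => Rabs (c a) * monom a (repeat r (m + 1))) <= B) /\
    (forall y, in_ball (m + 1) x r y ->
       Un_cv (fun N => box_sum (m + 1) N (fun a => c a * monom a (vsub y x))) (F j y))))
    as [c Hc].
  { intros j. destruct (Nat.lt_ge_cases j n) as [Hj|Hj].
    - destruct (HA j Hj) as (_ & _ & c & Hc). now exists c.
    - exists (fun _ => 0). lia. }
  exists (fun a j => c j a). split.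
  - exists B. intros N j Hj. now apply Hc.
  - intros y w Hy Hw j Hj. rewrite (PR_functional y w (vec n F y) Hw (HF y Hy)).
    rewrite vec_nth by exact Hj. now apply Hc.
Qed.

End Dependence.

Theorem theorem3p3 (m n : nat) (f g : pfun (list R) (list R))
  (Hf : vecfun_wf m n f) (Hg : vecfun_wf (m + 1 + n) n g) :
  ((analytic (m + 1 + n) n (graph_of g) /\ open_dom (m + 1 + n) (graph_of g)) ->
   forall v : list R, length v = m ->
   forall h : pfun R (list R),
     Hset n f g v h <->
     exists J : R -> Prop, dom_ok J /\
       (forall t, pdom h t <-> (J t /\ exists y, hv_graph n f g v t y)) /\
       (forall t, pdom h t -> hv_graph n f g v t (pval h t)))
  /\
  ((analytic m n (graph_of f) /\ open_dom m (graph_of f) /\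
    analytic (m + 1 + n) n (graph_of g) /\ open_dom (m + 1 + n) (graph_of g)) ->
   analytic (m + 1) n (PR_graph m n f g) /\ open_dom (m + 1) (PR_graph m n f g)).
Proof.
  split.
  - intros [Ha Ho] v Hv h. now apply (Hset_restrictions m).
  - intros (Haf & Hof & Hag & Hog). split; [now apply PR_analytic|now apply PR_open].
Qed.
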